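(* A linear map $\Phi: M_3(\mathbb{C}) \to M_3(\mathbb{C})$ is in $\mathcal{E}_3$ if and only if either $\Phi$ has the form $\Phi(A)=\rho(A)I$ for some faithful state $\rho \in M_3(\mathbb{C})^*$, or there is a unitary $U \in M_3(\mathbb{C})$ such that $\Psi:=\Phi_U$ is one of the following maps, where $A=(a_{ij}) \in M_3(\mathbb{C})$ is arbitrary: (I) $\Psi(A) = (\lambda a_{22} + (1-\lambda)a_{33})I$ for some $\lambda \in [0,1]$; (II) $\Psi(A) = \begin{pmatrix} \lambda a_{22} + (1-\lambda)a_{33} & 0 & 0 \\ 0 & a_{22} & 0 \\ 0 & 0 & a_{33}\end{pmatrix}$ for some $\lambda \in [0,1]$; (III) $\Psi(A) = \begin{pmatrix} \lambda a_{22} + (1-\lambda)a_{33} & 0 & 0 \\ 0 & a_{22} & a_{23} \\ 0 & a_{32} & a_{33}\end{pmatrix}$ for some $\lambda \in [0,1]$; (IV) $\Psi(A) = \begin{pmatrix} a_{11} & 0 & 0 \\ 0 & a_{22} & 0 \\ 0 & 0 & a_{33}\end{pmatrix}$; (V) $\Psi(A) = \begin{pmatrix} a_{11} & 0 & 0 \\ 0 & a_{22} & a_{23} \\ 0 & a_{32} & a_{33}\end{pmatrix}$; (VI) $\Psi(A) = \begin{pmatrix} a_{11} & 0 & 0 \\ 0 & \lambda a_{22} + (1-\lambda) a_{33} & 0 \\ 0 & 0 & \lambda a_{22} + (1-\lambda)a_{33}\end{pmatrix}$ for some $\lambda \in (0,1)$; (VII) $\Psi(A)=A$.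
   Context: $\mathcal{E}_n$ denotes the set of all unital completely positive linear maps $\Phi: M_n(\mathbb{C}) \to M_n(\mathbb{C})$ with $\Phi^2=\Phi\circ\Phi=\Phi$. For a linear map $\Phi: M_n(\mathbb{C}) \to M_n(\mathbb{C})$ and a unitary $U \in M_n(\mathbb{C})$, $\Phi_U$ is the map $\Phi_U(A) = U^*\Phi(UAU^* )U$; maps related this way are called conjugate. A state is a positive linear functional taking the value $1$ at $I$; it is faithful if it is strictly positive on every nonzero positive matrix. *)

(* Defs.v *)
From mathcomp Require Import all_boot all_order all_algebra.

Set Implicit Arguments.
Unset Strict Implicit.
Unset Printing Implicit Defensive.

Import Order.TTheory GRing.Theory Num.Theory.
Local Open Scope ring_scope.
Local Open Scope sesquilinear_scope.

Section MatrixMaps.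
Variable C : numClosedFieldType.

(* In a numClosedFieldType, 0 <= z entails that z is real; hence a matrix
   satisfying this predicate is automatically Hermitian. *)
Definition psdmx n (A : 'M[C]_n) : Prop :=
  forall x : 'cV[C]_n, 0 <= (x ^t* *m A *m x) 0 0.

Definition positive_map m n (Phi : 'M[C]_m -> 'M[C]_n) : Prop :=
  forall A, psdmx A -> psdmx (Phi A).

(* The map id_k (x) Phi, with M_k(M_n) identified with k x k block matrices
   whose blocks are n x n; Phi is applied to each block. *)
Definition amplification k m n (Phi : 'M[C]_m -> 'M[C]_n)
    (X : 'M[C]_(\sum_(i < k) m)) : 'M[C]_(\sum_(i < k) n) :=
  \mxblock_(i < k, j < k) Phi (submxblock X i j).

Definition completely_positive m n (Phi : 'M[C]_m -> 'M[C]_n) : Prop :=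
  forall k, positive_map (@amplification k m n Phi).

Definition unital m n (Phi : 'M[C]_m -> 'M[C]_n) : Prop :=
  Phi 1%:M = 1%:M.

Definition ucp_idempotent n (Phi : {linear 'M[C]_n -> 'M[C]_n}) : Prop :=
  [/\ unital Phi, completely_positive Phi & Phi \o Phi =1 Phi].

Definition map_conj n (U : 'M[C]_n) (Phi : 'M[C]_n -> 'M[C]_n) :
    'M[C]_n -> 'M[C]_n :=
  fun A => U ^t* *m Phi (U *m A *m U ^t*) *m U.

Definition is_state n (rho : {scalar 'M[C]_n}) : Prop :=
  (forall A, psdmx A -> 0 <= rho A) /\ rho 1%:M = 1.

Definition faithful_functional n (rho : {scalar 'M[C]_n}) : Prop :=
  forall A, psdmx A -> A != 0 -> 0 < rho A.

(* The 3 x 3 matrix with the given list of rows. *)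
Definition mx3 (rows : seq (seq C)) : 'M[C]_3 :=
  \matrix_(i, j) nth 0 (nth [::] rows i) j.

(* 1-based entry a_ij of a 3 x 3 matrix; only used for 1 <= i, j <= 3. *)
Definition entry (A : 'M[C]_3) (i j : nat) : C := A (inord i.-1) (inord j.-1).

End MatrixMaps.

(* Main.v *)
From HB Require Import structures.
Require Import Defs.
From mathcomp Require Import all_boot all_order all_algebra.
From mathcomp Require Import fingroup perm complex reals boolp ring.

Set Implicit Arguments.
Unset Strict Implicit.
Unset Printing Implicit Defensive.

Import Order.TTheory GRing.Theory Num.Theory.
Local Open Scope ring_scope.
Local Open Scope sesquilinear_scope.

(** A unital completely positive map [Phi] satisfies the Schwarz inequality
    [Phi(X)^* Phi(X) <= Phi(X^* X)] ([ucp_schwarz]), and this is all that the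
    classification of the idempotents uses.  Equality at [A] forces
    [Phi(A^* X) = Phi(A)^* Phi(X)] for every [X] ([multiplicative_domain]),
    because the defect [Phi(Y^* Z) - Phi(Y)^* Phi(Z)] is a positive
    sesquilinear form.  For an idempotent [Phi] this has two consequences.
    If [Phi] is faithful, then its fixed points form a *-algebra over which
    [Phi] is linear ([faithful_fixed_gram], [faithful_fixed_mul]); so as soon
    as a non-scalar matrix is fixed, so are the spectral projections of a
    non-scalar Hermitian matrix ([faithful_fixed_spectral]), one of which has
    rank one when the size is at most three.  If [Phi] is not faithful, it annihilates
    a rank one projection, hence the whole row and column of that projection
    ([kills_delta0_compress]).

    After a unitary conjugation the distinguished projection is the first
    diagonal matrix unit, and the compression of [Phi] to the other coordinates
    is again an idempotent Schwarz map, of smaller size ([kills_idem],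
    [fixes_idem]).  On 2 x 2 matrices such a map is, up to conjugation, a state
    times the identity, the diagonal projection, or the identity map
    ([schwarz_idem_M2]).

    When the first unit is annihilated, [Phi] factors through this compression,
    and the three possibilities give the forms (I), (II), (III)
    ([kills_standard]).  When [Phi] is faithful and fixes only scalars, it is a
    faithful state times the identity.  When [Phi] is faithful and fixes the
    first unit, either the compression is a state times the identity, and the
    result is (VI) ([fixes_scalar]); or all diagonal units are fixed, so that
    [Phi] multiplies each entry by 0 or 1, the entries with coefficient 1 being
    those of an equivalence relation on three points, and the result is (IV),
    (V) or (VII) ([schur_standard]).

    Conversely, each listed map is a sum of maps [c K^* A K] with [0 <= c],
    hence completely positive ([kraus_cp], [standard_form_cp]).  A state times
    the identity is brought to this shape by diagonalising the density matrix
    of the state ([positive_functional_diag], [state_ucp_idempotent]). *)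

(** * Adjoints, matrix units and unitary conjugation *)

Section Adjoint.
Variable C : numClosedFieldType.
Implicit Types m n p : nat.

Lemma ctrmxM m n p (A : 'M[C]_(m, n)) (B : 'M[C]_(n, p)) :
  (A *m B)^t* = B^t* *m A^t*.
Proof. by rewrite trmx_mul map_mxM. Qed.

Lemma ctrmxD m n (A B : 'M[C]_(m, n)) : (A + B)^t* = A^t* + B^t*.
Proof. by rewrite linearD /= map_mxD. Qed.

Lemma ctrmxN m n (A : 'M[C]_(m, n)) : (- A)^t* = - A^t*.
Proof. by rewrite linearN /= map_mxN. Qed.

Lemma ctrmxB m n (A B : 'M[C]_(m, n)) : (A - B)^t* = A^t* - B^t*.
Proof. by rewrite ctrmxD ctrmxN. Qed.

Lemma ctrmxZ m n (a : C) (A : 'M[C]_(m, n)) : (a *: A)^t* = a^* *: A^t*.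
Proof. by rewrite linearZ /= map_mxZ. Qed.

Lemma ctrmx0 m n : (0 : 'M[C]_(m, n))^t* = 0.
Proof. by rewrite trmx0 map_mx0. Qed.

Lemma ctrmx1 n : (1%:M : 'M[C]_n)^t* = 1%:M.
Proof. by rewrite trmx1 map_mx1. Qed.

Lemma ctrmx_sum m n (I : finType) (F : I -> 'M[C]_(m, n)) :
  (\sum_i F i)^t* = \sum_i (F i)^t*.
Proof. exact: (big_morph (fun A => A^t*) (@ctrmxD m n) (@ctrmx0 m n)). Qed.

Lemma ctrmx_delta m n i j : (delta_mx i j : 'M[C]_(m, n))^t* = delta_mx j i.
Proof. by rewrite trmx_delta map_delta_mx. Qed.

Lemma ctrmxE m n (A : 'M[C]_(m, n)) i j : A^t* i j = (A j i)^*.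
Proof. by rewrite !mxE. Qed.

Lemma addmxE m n (A B : 'M[C]_(m, n)) i j : (A + B) i j = A i j + B i j.
Proof. by rewrite mxE. Qed.

Lemma oppmxE m n (A : 'M[C]_(m, n)) i j : (- A) i j = - A i j.
Proof. by rewrite mxE. Qed.

Lemma scalemxE m n (a : C) (A : 'M[C]_(m, n)) i j : (a *: A) i j = a * A i j.
Proof. by rewrite mxE. Qed.

Lemma unitarymx_adj_mul n (U : 'M[C]_n) :
  U \is unitarymx -> U^t* *m U = 1%:M.
Proof. by move/unitarymxP/mulmx1C. Qed.

Lemma unitary_conjK n (U A : 'M[C]_n) :
  U \is unitarymx -> U^t* *m (U *m A *m U^t*) *m U = A.
Proof.
by move=> Uu; rewrite !mulmxA unitarymx_adj_mul // mul1mx mulmxKtV.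
Qed.

Lemma unitary_conjVK n (U A : 'M[C]_n) :
  U \is unitarymx -> U *m (U^t* *m A *m U) *m U^t* = A.
Proof.
by move=> Uu; have := @unitary_conjK _ (U^t*) A; rewrite trmxC_unitary trmxCK; apply.
Qed.

Lemma delta_sandwich m n (a : 'I_m) i j (b : 'I_n) (B : 'M[C]_(m, n)) :
  delta_mx a i *m B *m delta_mx j b = B i j *: delta_mx a b :> 'M[C]_(m, n).
Proof.
rewrite -(mul_delta_mx (0 : 'I_1) a i) -(mul_delta_mx (0 : 'I_1) j b).
rewrite -!mulmxA (mulmxA B) (mulmxA (delta_mx 0 i)) -colE -rowE.
rewrite (mx11_scalar (row i _)) mul_scalar_mx -scalemxAr mul_delta_mx.
by rewrite !mxE.
Qed.

Lemma perm_mx_unitary n (s : 'S_n) : (perm_mx s : 'M[C]_n) \is unitarymx.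
Proof.
apply/unitarymxP; rewrite tr_perm_mx map_perm_mx.
by rewrite -perm_mxM mulgV perm_mx1.
Qed.

Lemma perm_mx_conjE n (s : 'S_n) (A : 'M[C]_n) i j :
  (perm_mx s *m A *m (perm_mx s)^t*) i j = A (s i) (s j).
Proof.
by rewrite tr_perm_mx map_perm_mx -row_permE -col_permE !mxE.
Qed.

Lemma perm_conj_delta n (s : 'S_n) i :
  perm_mx s *m delta_mx i i *m (perm_mx s)^t* =
  delta_mx (s^-1 i)%g (s^-1 i)%g :> 'M[C]_n.
Proof.
apply/matrixP => j k; rewrite perm_mx_conjE !mxE.
by rewrite !(can2_eq (permK s) (permKV s)).
Qed.

Lemma perm_mx_conjVE n (s : 'S_n) (A : 'M[C]_n) i j :
  ((perm_mx s)^t* *m A *m perm_mx s) i j = A (s^-1 i)%g (s^-1 j)%g.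
Proof.
have := perm_mx_conjE s^-1 A i j; rewrite -tr_perm_mx trmxK.
by rewrite tr_perm_mx map_perm_mx map_perm_mx.
Qed.

End Adjoint.

(** * Positive semidefinite matrices *)

Section Psd.
Variable C : numClosedFieldType.
Implicit Types m n : nat.

Lemma psdmx_gram m n (Y : 'M[C]_(m, n)) : psdmx (Y^t* *m Y).
Proof.
move=> x; rewrite !mulmxA -ctrmxM -mulmxA mxE sumr_ge0 // => i _.
by rewrite ctrmxE mulrC mul_conjC_ge0.
Qed.

Lemma psdmxD n (A B : 'M[C]_n) : psdmx A -> psdmx B -> psdmx (A + B).
Proof.
by move=> pA pB x; rewrite mulmxDr mulmxDl mxE addr_ge0 ?pA ?pB.
Qed.

Lemma psdmxZ n (a : C) (A : 'M[C]_n) : 0 <= a -> psdmx A -> psdmx (a *: A).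
Proof.
by move=> a0 pA x; rewrite -scalemxAr -scalemxAl mxE mulr_ge0 ?pA.
Qed.

Lemma psdmx_sandwich m n (V : 'M[C]_(m, n)) (A : 'M[C]_m) :
  psdmx A -> psdmx (V^t* *m A *m V).
Proof. by move=> pA x; have := pA (V *m x); rewrite ctrmxM !mulmxA. Qed.

Lemma psdmx_entry n (A : 'M[C]_n) : psdmx A -> forall i, 0 <= A i i.
Proof.
by move=> pA i; have := pA (delta_mx i 0); rewrite ctrmx_delta -rowE -colE !mxE.
Qed.

(** Polarization: the values at [u + v] and [u + 'i v] recover the sesquilinear
    form from the quadratic one. *)
Lemma qform_eq0 n (M : 'M[C]_n) :
  (forall x : 'cV[C]_n, (x^t* *m M *m x) 0 0 = 0) -> M = 0.
Proof.
move=> M0.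
have Mp (u v : 'cV[C]_n) :
    (u^t* *m M *m v) 0 0 + (v^t* *m M *m u) 0 0 = 0.
  have := M0 (u + v); rewrite ctrmxD !mulmxDl !mulmxDr.
  by rewrite !addmxE !M0 add0r addr0.
have Mz (u v : 'cV[C]_n) : (u^t* *m M *m v) 0 0 = 0.
  have h1 := Mp u v; have := Mp u ('i *: v).
  rewrite ctrmxZ conjCi -!scalemxAr -!scalemxAl !scalemxE.
  rewrite mulNr -mulrBr => /eqP; rewrite mulf_eq0 (negbTE (neq0Ci _)) /=.
  rewrite subr_eq0 => /eqP h2; move: h1; rewrite -h2 -mulr2n => /eqP.
  by rewrite mulrn_eq0 => /eqP.
apply/matrixP => i j; have := Mz (delta_mx i 0) (delta_mx j 0).
by rewrite ctrmx_delta -rowE -colE !mxE.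
Qed.

Lemma psdmx_adj n (A : 'M[C]_n) : psdmx A -> A^t* = A.
Proof.
move=> pA; apply/eqP; rewrite -subr_eq0; apply/eqP/qform_eq0 => x.
rewrite mulmxBr mulmxBl mxE [X in _ + X]mxE.
have -> : x^t* *m A^t* *m x = (x^t* *m A *m x)^t*.
  by rewrite !ctrmxM trmxCK mulmxA.
by rewrite ctrmxE geC0_conj ?subrr.
Qed.

Lemma psdmx_anti n (A : 'M[C]_n) : psdmx A -> psdmx (- A) -> A = 0.
Proof.
move=> pA nA; apply: qform_eq0 => x; apply/eqP; rewrite eq_le pA andbT.
by have := nA x; rewrite mulmxN mulNmx mxE oppr_ge0.
Qed.

Lemma gram_eq0 m n (Y : 'M[C]_(m, n)) : Y^t* *m Y = 0 -> Y = 0.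
Proof.
move=> YY; apply/matrixP => i j; have /matrixP/(_ j j) := YY.
rewrite !mxE => /eqP; rewrite psumr_eq0 => [/allP/(_ i)|k _].
  rewrite mem_index_enum ctrmxE mulrC mul_conjC_eq0 => /(_ isT).
  by move/eqP.
by rewrite ctrmxE mulrC mul_conjC_ge0.
Qed.

Lemma psdmx_spectral n (A : 'M[C]_n) : psdmx A ->
  exists2 P : 'M[C]_n, P \is unitarymx &
  exists2 d : 'rV[C]_n, (forall i, 0 <= d 0 i) & A = P^t* *m diag_mx d *m P.
Proof.
move=> pA; have /hermitian_normalmx/orthomx_spectralP : A \is hermsymmx.
  by apply/is_hermitianmxP; rewrite expr0 scale1r psdmx_adj.
have Pu := spectral_unitarymx A; rewrite (invmx_unitary Pu).
set P := spectralmx A in Pu *; set d := spectral_diag A => defA.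
exists P => //; exists d => // i.
have := psdmx_sandwich (P^t*) pA; rewrite trmxCK {1}defA !mulmxA.
rewrite (unitarymxP Pu) mul1mx -mulmxA (unitarymxP Pu) mulmx1.
by move/psdmx_entry/(_ i); rewrite mxE eqxx.
Qed.

Lemma diag_mx_gram n (d : 'rV[C]_n) : (forall i, 0 <= d 0 i) ->
  let s := map_mx sqrtC d in (diag_mx s)^t* *m diag_mx s = diag_mx d.
Proof.
move=> d0 s; rewrite tr_diag_mx map_diag_mx mulmx_diag; congr diag_mx.
apply/rowP => i; rewrite /s !mxE /= geC0_conj ?sqrtC_ge0 //.
by rewrite -expr2 sqrtCK.
Qed.

Lemma psdmx_gramP n (A : 'M[C]_n) :
  psdmx A -> exists B : 'M[C]_n, A = B^t* *m B.
Proof.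
case/psdmx_spectral => P Pu [d d0 ->].
exists (diag_mx (map_mx sqrtC d) *m P).
by rewrite -(diag_mx_gram d0) ctrmxM !mulmxA.
Qed.

Lemma psdmx_diag n (d : 'rV[C]_n) :
  (forall i, 0 <= d 0 i) -> psdmx (diag_mx d).
Proof. by move=> d0; rewrite -(diag_mx_gram d0); apply: psdmx_gram. Qed.

Lemma diag_mx_delta n (i : 'I_n) :
  diag_mx (delta_mx 0 i) = delta_mx i i :> 'M[C]_n.
Proof.
apply/matrixP => j k; rewrite !mxE eqxx /=.
have [->|jk] := eqVneq j k; first by rewrite andbb mulr1n.
rewrite mulr0n; have [ji|//] := eqVneq j i.
by rewrite -ji eq_sym (negPf jk).
Qed.

Lemma psdmx_delta n (i : 'I_n) : psdmx (delta_mx i i : 'M[C]_n).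
Proof.
by rewrite -diag_mx_delta; apply: psdmx_diag => k; rewrite mxE ler0n.
Qed.

(** Every linear functional is [A |-> \tr (D *m A)]; positivity on the rank one
    matrices [x x^*] says that [D] is positive semidefinite, and [U] is a
    unitary that diagonalises [D]. *)
Lemma positive_functional_diag n (rho : {scalar 'M[C]_n}) :
  (forall A, psdmx A -> 0 <= rho A) ->
  exists2 U : 'M[C]_n, U \is unitarymx &
  exists2 d : 'I_n -> C, (forall i, 0 <= d i) &
    forall A, rho (U *m A *m U^t*) = \sum_i d i * A i i.
Proof.
move=> rho_ge0; pose D : 'M[C]_n := \matrix_(i, j) rho (delta_mx j i).
have rhoE A : rho A = \tr (D *m A).
  rewrite mxtrace_mulC {1}[A]matrix_sum_delta linear_sum.
  apply: eq_bigr => i _; rewrite mxE linear_sum; apply: eq_bigr => j _.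
  by rewrite linearZ mxE.
have pD : psdmx D.
  move=> x; have := rho_ge0 _ (psdmx_gram (x^t*)); rewrite rhoE trmxCK.
  rewrite mulmxA mxtrace_mulC mulmxA /mxtrace big_ord1; exact.
have [P Pu [d d0 defD]] := psdmx_spectral pD.
exists (P^t*); first by rewrite trmxC_unitary.
exists (d 0) => // A; rewrite rhoE defD trmxCK mxtrace_mulC.
rewrite -!mulmxA (mulmxA P) (unitarymxP Pu) mul1mx.
rewrite mxtrace_mulC -!mulmxA (unitarymxP Pu) mulmx1 mxtrace_mulC.
by apply: eq_bigr => i _; rewrite mul_diag_mx mxE.
Qed.

End Psd.

(** * Schwarz maps *)

Section Schwarz.
Variable C : numClosedFieldType.
Implicit Types m n : nat.

(** The hypothesis under which the classification is carried out.  Unlike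
    complete positivity it involves no amplification, and it passes to
    compressions by a direct computation. *)
Definition schwarz n (Phi : 'M[C]_n -> 'M[C]_n) : Prop :=
  [/\ unital Phi,
      forall X, Phi (X^t*) = (Phi X)^t* &
      forall X, psdmx (Phi (X^t* *m X) - (Phi X)^t* *m Phi X)].

Definition faithful_map n (Phi : 'M[C]_n -> 'M[C]_n) : Prop :=
  forall A, psdmx A -> Phi A = 0 -> A = 0.

(** At a small multiple of [- a^*] the linear terms dominate the quadratic one
    and are negative unless [a] vanishes. *)
Lemma quadratic_ge0_linear_coef0 (a c : C) : 0 <= c ->
  (forall t : C, 0 <= t * a + t^* * a^* + t^* * t * c) -> a = 0.
Proof.
(* The step [s = 1 / (1 + c)] satisfies [s * c < 1], so the value of the
   quadratic is [- |a|^2 * s * (2 - s * c)]. *)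
move=> c0 /(_ (- (1 + c)^-1 * a^*)); set s := (1 + c)^-1.
have s0 : 0 < s by rewrite invr_gt0 ltr_wpDr.
have sc : s * c < 1.
  by rewrite mulrC ltr_pdivrMr ?mul1r ?ltrDr // ltr_wpDr.
rewrite rmorphM rmorphN /= conjCK (geC0_conj (ltW s0)).
have -> : - s * a^* * a + - s * a * a^* + - s * a * (- s * a^*) * c =
          - (a * a^*) * (s * (2 - s * c)) by ring.
rewrite mulNr oppr_ge0 pmulr_lle0; last first.
  by rewrite mulr_gt0 // subr_gt0 (lt_trans sc) // ltr1n.
move=> a_le0; apply/eqP; rewrite -mul_conjC_eq0.
by rewrite eq_le a_le0 mul_conjC_ge0.
Qed.

(** The defect [D Y Z = Phi (Y^* Z) - Phi(Y)^* Phi(Z)] is a positive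
    sesquilinear form with values in matrices, so [D A A = 0] implies
    [D A X = 0]: otherwise [D] would be negative at some [A + t X]. *)
Lemma multiplicative_domain n (Phi : {linear 'M[C]_n -> 'M[C]_n}) A :
    schwarz Phi -> Phi (A^t* *m A) = (Phi A)^t* *m Phi A ->
  forall X, Phi (A^t* *m X) = (Phi A)^t* *m Phi X.
Proof.
case=> _ Padj Psch PA X; apply/eqP; rewrite -subr_eq0; apply/eqP.
pose D (Y Z : 'M[C]_n) := Phi (Y^t* *m Z) - (Phi Y)^t* *m Phi Z.
have Dadj Y Z : (D Y Z)^t* = D Z Y.
  by rewrite /D ctrmxB ctrmxM trmxCK -Padj ctrmxM trmxCK.
have Dexp t : D (A + t *: X) (A + t *: X) =
    t *: D A X + t^* *: D X A + (t^* * t) *: D X X.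
  have PD : Phi (A + t *: X) = Phi A + t *: Phi X by rewrite linearD linearZ.
  rewrite /D PD !ctrmxD !ctrmxZ.
  rewrite !(mulmxDl, mulmxDr) -!(scalemxAl, scalemxAr).
  rewrite !(linearD, linearZ) /= PA.
  apply/matrixP => i j; rewrite !(addmxE, oppmxE, scalemxE); ring.
have Dpsd Y : psdmx (D Y Y) by apply: Psch.
rewrite -/(D A X); clearbody D; apply: qform_eq0 => y.
apply: (quadratic_ge0_linear_coef0 (Dpsd X y)) => t.
have := Dpsd (A + t *: X) y; rewrite Dexp -(Dadj A X).
rewrite !(mulmxDl, mulmxDr) -!(scalemxAl, scalemxAr).
by rewrite !addmxE !scalemxE -ctrmxE !ctrmxM trmxCK !mulmxA.
Qed.

Section SchwarzTheory.
Variables (n : nat) (Phi : {linear 'M[C]_n -> 'M[C]_n}).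
Hypothesis schPhi : schwarz Phi.
Implicit Types A P X Y : 'M[C]_n.

Lemma schwarz_pos : positive_map Phi.
Proof.
move=> A /psdmx_gramP[B ->]; case: schPhi => _ _ Psch.
rewrite -[Phi _](subrK ((Phi B)^t* *m Phi B)).
by apply: psdmxD (psdmx_gram _).
Qed.

(** If [Phi] annihilates [A^* A], the Schwarz inequality gives [Phi A = 0], so
    [A] lies in the multiplicative domain. *)
Lemma schwarz_gram_eq0 (A : 'M[C]_n) :
  Phi (A^t* *m A) = 0 -> forall X : 'M[C]_n, Phi (A^t* *m X) = 0.
Proof.
case: (schPhi) => _ _ Psch PA0.
have PA : Phi A = 0.
  apply: gram_eq0; apply: psdmx_anti; first exact: psdmx_gram.
  by have := Psch A; rewrite PA0 sub0r.
by move=> X; rewrite (multiplicative_domain schPhi) PA ?ctrmx0 ?mul0mx.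
Qed.

(** A fixed projection lies in the multiplicative domain. *)
Lemma schwarz_fixed_projl P : P^t* = P -> P *m P = P -> Phi P = P ->
  forall X, Phi (P *m X) = P *m Phi X.
Proof.
move=> Padj PP PhiP X.
by rewrite -{1}Padj (multiplicative_domain schPhi) PhiP Padj ?PP.
Qed.

Lemma schwarz_fixed_projr P : P^t* = P -> P *m P = P -> Phi P = P ->
  forall X, Phi (X *m P) = Phi X *m P.
Proof.
case: (schPhi) => _ adjPhi _ Padj PP PhiP X.
apply: (can_inj (@trmxCK _ _ _)).
by rewrite -adjPhi !ctrmxM Padj schwarz_fixed_projl // adjPhi.
Qed.

Section Faithful.
Hypothesis idPhi : Phi \o Phi =1 Phi.
Hypothesis faithPhi : faithful_map Phi.

(** For fixed [X] the matrix [Phi (X^* X) - X^* X] is positive semidefinite by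
    the Schwarz inequality, and idempotence puts it in the kernel of [Phi]. *)
Lemma faithful_fixed_gram X : Phi X = X -> Phi (X^t* *m X) = X^t* *m X.
Proof.
case: (schPhi) => _ _ Psch PX; apply/eqP; rewrite -subr_eq0; apply/eqP.
apply: faithPhi; first by have := Psch X; rewrite PX.
by rewrite linearB /=; have /= -> := idPhi (X^t* *m X); rewrite subrr.
Qed.

Lemma faithful_fixed_mul X Y : Phi X = X -> Phi (X *m Y) = X *m Phi Y.
Proof.
case: (schPhi) => _ adjPhi _ PX.
have PX' : Phi (X^t*) = X^t* by rewrite adjPhi PX.
rewrite -[X in LHS]trmxCK (multiplicative_domain schPhi) PX' ?trmxCK //.
by have := faithful_fixed_gram PX'; rewrite trmxCK.
Qed.

End Faithful.
End SchwarzTheory.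

Section Squeeze.
Variables m n : nat.
Implicit Types (V : 'M[C]_(m, n)) (Phi : {linear 'M[C]_m -> 'M[C]_m}).

(** For a square [V] this is [map_conj]; for an isometry [V] it is the
    compression of [Phi] to the range of [V].  Treating both at once lets
    unitary conjugations and passages to smaller matrices compose
    ([compression_comp]). *)
Definition compression V (Phi : 'M[C]_m -> 'M[C]_m) (A : 'M[C]_n) : 'M[C]_n :=
  V^t* *m Phi (V *m A *m V^t*) *m V.

Fact compression_is_linear V Phi : linear (compression V Phi).
Proof.
move=> a A B; rewrite /compression mulmxDr mulmxDl -scalemxAr -scalemxAl linearP.
by rewrite mulmxDr mulmxDl -scalemxAr -scalemxAl.
Qed.
HB.instance Definition _ V Phi :=
  GRing.isLinear.Build C 'M[C]_n 'M[C]_n *:%R (compression V Phi)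
    (compression_is_linear V Phi).

(** Compressing [Phi(Z)^* Phi(Z)] gives more than the square of the compression
    of [Phi(Z)]: the difference is a Gram matrix, because [1 - V V^*] is a
    projection. *)
Lemma compression_schwarz V Phi : V^t* *m V = 1%:M ->
  V^t* *m Phi (V *m V^t*) *m V = 1%:M -> schwarz Phi -> schwarz (compression V Phi).
Proof.
move=> VV uV [_ adjPhi Psch]; split.
- by rewrite /unital /compression mulmx1.
- by move=> X; rewrite /compression !ctrmxM -adjPhi !ctrmxM trmxCK !mulmxA.
move=> X; set Z := V *m X *m V^t*; set Y := Phi Z.
have -> : compression V Phi (X^t* *m X) = V^t* *m Phi (Z^t* *m Z) *m V.
  by rewrite /compression /Z !ctrmxM trmxCK !mulmxA -(mulmxA _ (V^t*)) VV mulmx1.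
have -> : compression V Phi X = V^t* *m Y *m V by [].
set W := 1%:M - V *m V^t*.
have WW : W^t* *m W = W.
  rewrite /W ctrmxB ctrmx1 ctrmxM trmxCK mulmxBl mul1mx mulmxBr mulmx1.
  by rewrite mulmxA -(mulmxA V) VV mulmx1 subrr subr0.
have -> : V^t* *m Phi (Z^t* *m Z) *m V - (V^t* *m Y *m V)^t* *m (V^t* *m Y *m V)
  = V^t* *m (Phi (Z^t* *m Z) - Y^t* *m Y) *m V +
    (W *m (Y *m V))^t* *m (W *m (Y *m V)).
  rewrite [(W *m _)^t*]ctrmxM -[_ *m (W *m _)]mulmxA (mulmxA (W^t*)) WW /W.
  rewrite !(ctrmxM, trmxCK) !(mulmxBl, mulmxBr, mulmxA) mulmx1.
  by rewrite [RHS]addrA subrK.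
apply: psdmxD; first exact: psdmx_sandwich.
exact: psdmx_gram.
Qed.

End Squeeze.
End Schwarz.

(** * Complete positivity *)

Section CompletePositivity.
Variable C : numClosedFieldType.
Implicit Types k n : nat.

Lemma ctrmx_mxcol k n (z : 'I_k -> 'cV[C]_n) :
  (\mxcol_i z i)^t* = \mxrow_i (z i)^t*.
Proof. by apply/matrixP => i j; rewrite !mxE. Qed.

Lemma ctrmx_mxblock k n (B : 'I_k -> 'I_k -> 'M[C]_n) :
  (\mxblock_(i, j) B i j)^t* = \mxblock_(i, j) (B j i)^t*.
Proof. by apply/matrixP => i j; rewrite !mxE. Qed.

Lemma psdmx_mxblockP k n (B : 'I_k -> 'I_k -> 'M[C]_n) :
  psdmx (\mxblock_(i, j) B i j) <->
  forall z : 'I_k -> 'cV[C]_n,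
    0 <= \sum_i \sum_j ((z i)^t* *m B i j *m z j) 0 0.
Proof.
have qfE (z : 'I_k -> 'cV[C]_n) :
    ((\mxcol_i z i)^t* *m (\mxblock_(i, j) B i j) *m (\mxcol_i z i)) 0 0 =
    \sum_i \sum_j ((z i)^t* *m B i j *m z j) 0 0.
  rewrite ctrmx_mxcol mul_mxrow_mxblock mul_mxrow_mxcol exchange_big /=.
  rewrite summxE; apply: eq_bigr => j _.
  by rewrite mulmx_suml summxE.
split=> [pB z | pB x]; first by rewrite -qfE; apply: pB.
by rewrite -(submxcolK x) qfE; apply: pB.
Qed.

(** The block matrix [(A_i^* A_j)] is the Gram matrix of the block row [(A_i)],
    so its image under the amplification is positive semidefinite. *)
Lemma cp_gram k n (Phi : 'M[C]_n -> 'M[C]_n) (A : 'I_k -> 'M[C]_n) :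
  completely_positive Phi ->
  psdmx (\mxblock_(i < k, j < k) Phi ((A i)^t* *m A j)).
Proof.
move=> /(_ k (\mxblock_(i < k, j < k) ((A i)^t* *m A j))).
have -> : amplification Phi (\mxblock_(i < k, j < k) ((A i)^t* *m A j)) =
          \mxblock_(i < k, j < k) Phi ((A i)^t* *m A j).
  by apply/eq_mxblock => i j; rewrite mxblockK.
apply; apply/psdmx_mxblockP => z.
have -> : \sum_i \sum_j ((z i)^t* *m ((A i)^t* *m A j) *m z j) 0 0 =
   ((\sum_i A i *m z i)^t* *m (\sum_i A i *m z i)) 0 0.
  rewrite ctrmx_sum mulmx_suml summxE.
  apply: eq_bigr => i _; rewrite mulmx_sumr summxE; apply: eq_bigr => j _.
  by rewrite ctrmxM !mulmxA.
by have := @psdmx_gram C _ _ (\sum_i A i *m z i) 1%:M; rewrite ctrmx1 mul1mx mulmx1.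
Qed.

(** The usual 2-positivity argument, with the block row [(1, X)].  Self-adjointness
    of the resulting 2 x 2 block matrix makes [Phi] commute with adjoints; its value
    at the block vector [(- Phi(X) v, v)] gives the Schwarz inequality at [v]. *)
Lemma ucp_schwarz n (Phi : {linear 'M[C]_n -> 'M[C]_n}) :
  unital Phi -> completely_positive Phi -> schwarz Phi.
Proof.
move=> uPhi cpPhi.
pose A (X : 'M[C]_n) (i : 'I_2) := if i == 0 then 1%:M else X.
have pA X := cp_gram (A X) cpPhi.
have adjPhi X : Phi (X^t*) = (Phi X)^t*.
  have := psdmx_adj (pA X); rewrite ctrmx_mxblock => /eq_mxblockP/(_ 1 0).
  by rewrite /A /= ctrmx1 mul1mx mulmx1 => <-.
split=> // X v; pose u := - (Phi X *m v).
have /psdmx_mxblockP/(_ (fun i => if i == 0 then u else v)) := pA X.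
rewrite !big_ord_recl !big_ord0 /A /= !addr0 !ctrmx1 !mul1mx !mulmx1.
have -> : Phi 1%:M = 1%:M by [].
rewrite mulmx1 /u ctrmxN ctrmxM !(mulNmx, mulmxN) opprK !mulmxA !oppmxE.
rewrite mulmxBr mulmxBl addmxE oppmxE !mulmxA.
by rewrite subrr add0r addrC adjPhi.
Qed.

Lemma completely_positiveP m n (Phi : 'M[C]_m -> 'M[C]_n) :
  (forall k (B : 'I_k -> 'I_k -> 'M[C]_m),
    (forall z : 'I_k -> 'cV[C]_m,
      0 <= \sum_i \sum_j ((z i)^t* *m B i j *m z j) 0 0) ->
    forall z : 'I_k -> 'cV[C]_n,
      0 <= \sum_i \sum_j ((z i)^t* *m Phi (B i j) *m z j) 0 0) ->
  completely_positive Phi.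
Proof.
move=> cpPhi k X pX; apply/psdmx_mxblockP; apply: cpPhi.
by apply/psdmx_mxblockP; rewrite submxblockK.
Qed.

(** Weights are kept separate from the operators so that no square root of a
    weight is needed. *)
Lemma kraus_cp m n (Phi : 'M[C]_m -> 'M[C]_n) (s : seq (C * 'M[C]_(m, n))) :
  (forall p, p \in s -> 0 <= p.1) ->
  (forall A, Phi A = \sum_(p <- s) p.1 *: (p.2^t* *m A *m p.2)) ->
  completely_positive Phi.
Proof.
move=> c0 PhiE; apply: completely_positiveP => k B pB z.
have -> : \sum_i \sum_j ((z i)^t* *m Phi (B i j) *m z j) 0 0 =
  \sum_(p <- s) p.1 *
    \sum_i \sum_j ((p.2 *m z i)^t* *m B i j *m (p.2 *m z j)) 0 0.
  under [RHS]eq_bigr do rewrite mulr_sumr.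
  rewrite [RHS]exchange_big; apply: eq_bigr => i _ /=.
  under [RHS]eq_bigr do rewrite mulr_sumr.
  rewrite [RHS]exchange_big; apply: eq_bigr => j _ /=.
  rewrite PhiE mulmx_sumr mulmx_suml summxE; apply: eq_bigr => p _.
  by rewrite -scalemxAr -scalemxAl scalemxE ctrmxM !mulmxA.
rewrite big_seq sumr_ge0 // => p sp; rewrite mulr_ge0 ?c0 //.
Qed.

Lemma compression_cp m n (V : 'M[C]_(m, n)) (Phi : 'M[C]_m -> 'M[C]_m) :
  completely_positive Phi -> completely_positive (compression V Phi).
Proof.
move=> cpPhi; apply: completely_positiveP => k B pB z.
have : psdmx (\mxblock_(i < k, j < k) (V *m B i j *m V^t*)).
  apply/psdmx_mxblockP => y; have := pB (fun i => V^t* *m y i).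
  congr (0 <= _); apply: eq_bigr => i _; apply: eq_bigr => j _.
  by rewrite ctrmxM trmxCK !mulmxA.
move/cpPhi; rewrite /amplification => /psdmx_mxblockP/(_ (fun i => V *m z i)).
congr (0 <= _); apply: eq_bigr => i _; apply: eq_bigr => j _.
by rewrite mxblockK ctrmxM !mulmxA.
Qed.

End CompletePositivity.

(** * Idempotent Schwarz maps and their compressions *)

Section SchwarzIdempotents.
Variable C : numClosedFieldType.
Implicit Types m n p : nat.

Definition schwarz_idem n (Phi : 'M[C]_n -> 'M[C]_n) : Prop :=
  schwarz Phi /\ Phi \o Phi =1 Phi.

Lemma compression_comp m n p (V : 'M[C]_(m, n)) (W : 'M[C]_(n, p)) Phi A :
  compression W (compression V Phi) A = compression (V *m W) Phi A.
Proof. by rewrite /compression !ctrmxM !mulmxA. Qed.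

Lemma compression1 n (Phi : 'M[C]_n -> 'M[C]_n) : compression 1%:M Phi = Phi.
Proof. by apply: funext => A; rewrite /compression ctrmx1 !mulmx1 !mul1mx. Qed.

(** The compression of an idempotent is idempotent provided that, seen from the
    range of [V], the map depends only on the compressed part of its
    argument. *)
Lemma compression_schwarz_idem m n (V : 'M[C]_(m, n))
    (Phi : {linear 'M[C]_m -> 'M[C]_m}) :
  V^t* *m V = 1%:M ->
  (forall A, V^t* *m Phi (V *m V^t* *m A *m (V *m V^t*)) *m V =
             V^t* *m Phi A *m V) ->
  schwarz_idem Phi -> schwarz_idem (compression V Phi).
Proof.
move=> VV comp [schPhi idPhi]; split.
  apply: compression_schwarz => //; have := comp 1%:M; rewrite mulmx1.
  rewrite mulmxA -(mulmxA V) VV mulmx1 => ->.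
  by case: schPhi => -> _ _; rewrite mulmx1.
move=> A /=; rewrite {1}/compression.
have -> : V *m compression V Phi A *m V^t* =
   V *m V^t* *m Phi (V *m A *m V^t*) *m (V *m V^t*).
  by rewrite /compression !mulmxA.
by rewrite comp; have /= -> := idPhi (V *m A *m V^t*).
Qed.

Lemma compression_unitary_idem n (U : 'M[C]_n) (Phi : {linear 'M[C]_n -> 'M[C]_n}) :
  U \is unitarymx -> schwarz_idem Phi -> schwarz_idem (compression U Phi).
Proof.
move=> Uu; apply: compression_schwarz_idem; first exact: unitarymx_adj_mul.
by move=> A; rewrite (unitarymxP Uu) mulmx1 mul1mx.
Qed.

Lemma compression_unitary_faithful n (U : 'M[C]_n)
    (Phi : {linear 'M[C]_n -> 'M[C]_n}) :
  U \is unitarymx -> faithful_map Phi -> faithful_map (compression U Phi).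
Proof.
move=> Uu faith A pA; rewrite /compression => PA0.
have UAU0 : U *m A *m U^t* = 0.
  apply: faith; first by have := psdmx_sandwich (U^t*) pA; rewrite trmxCK.
  by rewrite -[Phi _](unitary_conjVK _ Uu) PA0 mulmx0 mul0mx.
by rewrite -(unitary_conjK A Uu) UAU0 mulmx0 mul0mx.
Qed.

(** A non-zero positive semidefinite matrix in the kernel dominates a positive
    multiple of one of its spectral projections of rank one, which is then in
    the kernel as well; a unitary moves this projection to the first matrix
    unit. *)
Lemma faithful_or_kills n (Phi : {linear 'M[C]_n.+1 -> 'M[C]_n.+1}) :
  schwarz Phi -> faithful_map Phi \/
  exists2 U : 'M[C]_n.+1, U \is unitarymx & compression U Phi (delta_mx 0 0) = 0.
Proof.
move=> schPhi.
case: (EM (faithful_map Phi)) => [|nfaith]; [by left | right].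
have [A [pA PA0 A0]] : exists A, [/\ psdmx A, Phi A = 0 & A != 0].
  apply: contrapT => noA; apply: nfaith => A pA PA0.
  by apply: contrapT => /eqP A0; apply: noA; exists A.
have [P Pu [d d0 defA]] := psdmx_spectral pA.
have [i di] : exists i, d 0 i != 0.
  apply: contrapT => /forallNP d_eq0; case/eqP: A0; rewrite defA.
  suff -> : d = 0 by rewrite linear0 mulmx0 mul0mx.
  by apply/rowP => i; rewrite mxE; apply/eqP; have /negP/negPn := d_eq0 i.
have Pi0 : Phi (P^t* *m delta_mx i i *m P) = 0.
  have pi (e : 'rV[C]_n.+1) : (forall j, 0 <= e 0 j) ->
      psdmx (Phi (P^t* *m diag_mx e *m P)).
    by move=> e0; apply/(schwarz_pos schPhi)/psdmx_sandwich/psdmx_diag.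
  rewrite -diag_mx_delta; apply: psdmx_anti.
    by apply: pi => j; rewrite mxE ler0n.
  have -> : - Phi (P^t* *m diag_mx (delta_mx 0 i) *m P) = (d 0 i)^-1 *:
     Phi (P^t* *m diag_mx (d - d 0 i *: delta_mx 0 i) *m P).
    rewrite linearB linearZ /= mulmxBr mulmxBl -defA linearB PA0 sub0r.
    by rewrite -scalemxAr -scalemxAl linearZ scalerN scalerA mulVf // scale1r.
  apply: psdmxZ; first by rewrite invr_ge0.
  apply: pi => j; rewrite !mxE eqxx /=; case: eqP => [->|_].
    by rewrite mulr1 subrr.
  by rewrite mulr0 subr0.
pose s := tperm i 0; exists (P^t* *m perm_mx s).
  by rewrite mul_unitarymx ?trmxC_unitary // perm_mx_unitary.
rewrite -compression_comp.
have Ei0 : compression (P^t*) Phi (delta_mx i i) = 0.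
  by rewrite /compression trmxCK Pi0 mulmx0 mul0mx.
rewrite {1}/compression.
have -> : perm_mx s *m delta_mx 0 0 *m (perm_mx s)^t* = delta_mx i i :> 'M[C]_n.+1.
  by rewrite perm_conj_delta tpermV tpermR.
by rewrite Ei0 mulmx0 mul0mx.
Qed.

End SchwarzIdempotents.

(** * Splitting off the first coordinate *)

Section Corner.
Variable C : numClosedFieldType.
Implicit Types n : nat.

(** The isometry that embeds an [n]-dimensional space as the last [n] coordinates
    of an [n.+1]-dimensional one. *)
Definition tailmx n : 'M[C]_(n.+1, n) := \matrix_(i, j) (i == lift ord0 j)%:R.

Lemma mulmx_tail m n (A : 'M[C]_(m, n.+1)) i j :
  (A *m tailmx n) i j = A i (lift ord0 j).
Proof.
rewrite mxE (bigD1 (lift ord0 j)) //= big1 => [|k /negPf kj].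
  by rewrite mxE eqxx mulr1 addr0.
by rewrite mxE kj mulr0.
Qed.

Lemma tailmx_compress n (A : 'M[C]_n.+1) i j :
  ((tailmx n)^t* *m A *m tailmx n) i j = A (lift ord0 i) (lift ord0 j).
Proof.
rewrite mulmx_tail -[_ *m A]trmxCK ctrmxE ctrmxM trmxCK mulmx_tail.
by rewrite ctrmxE conjCK.
Qed.

Lemma compress_gram n (Y : 'M[C]_n.+1) j : let t := tailmx n in
  (t^t* *m (Y^t* *m Y) *m t) j j = (Y 0 (lift ord0 j))^* * Y 0 (lift ord0 j) +
  ((t^t* *m Y *m t)^t* *m (t^t* *m Y *m t)) j j.
Proof.
move=> t; rewrite tailmx_compress mxE big_ord_recl ctrmxE; congr (_ + _).
rewrite mxE; apply: eq_bigr => k _.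
by rewrite !ctrmxE !tailmx_compress.
Qed.

Lemma tailmx_isometry n : (tailmx n)^t* *m tailmx n = 1%:M.
Proof.
apply/matrixP => i j; have := tailmx_compress 1%:M i j; rewrite mulmx1 => ->.
by rewrite !mxE (inj_eq lift_inj).
Qed.

Lemma tailmx_range n : tailmx n *m (tailmx n)^t* = 1%:M - delta_mx 0 0.
Proof.
apply/matrixP => i j; rewrite !mxE.
under eq_bigr do rewrite !mxE conjC_nat -natrM mulnb.
have [i' ->|->] := unliftP ord0 i.
  rewrite (bigD1 i') //= big1 => [|k /negPf ki]; last first.
    by rewrite (inj_eq lift_inj) eq_sym ki.
  by rewrite eqxx /= addr0 subr0 eq_sym.
rewrite big1 => [|k _]; last by rewrite (negPf (neq_lift _ _)).
rewrite eqxx /= eq_sym; case: eqP => _; rewrite ?subrr ?subr0 //.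
Qed.

Lemma tailmx_delta n i j :
  tailmx n *m delta_mx i j *m (tailmx n)^t* =
  delta_mx (lift ord0 i) (lift ord0 j).
Proof.
apply/matrixP => k l; rewrite -(mul_delta_mx (0 : 'I_1)) mulmxA -mulmxA.
by rewrite mxE big_ord1 -colE -rowE !mxE conjC_nat -natrM mulnb.
Qed.

(** The block diagonal matrix with blocks [1] and [u]; it extends a unitary of
    the last coordinates to all of them. *)
Definition corner1 n (u : 'M[C]_n) : 'M[C]_n.+1 :=
  delta_mx 0 0 + tailmx n *m u *m (tailmx n)^t*.

Lemma tailmx_adj_delta n k : (tailmx n)^t* *m delta_mx 0 k = 0 :> 'M[C]_(n, n.+1).
Proof.
apply/matrixP => i j; rewrite -(mul_delta_mx (0 : 'I_1)) mulmxA mxE big_ord1.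
by rewrite -colE !mxE (negPf (neq_lift _ _)) rmorph0 mul0r.
Qed.

Lemma delta_tailmx n k : delta_mx k 0 *m tailmx n = 0 :> 'M[C]_(n.+1, n).
Proof.
apply: (can_inj (@trmxCK _ _ _)).
by rewrite ctrmxM ctrmx_delta tailmx_adj_delta ctrmx0.
Qed.

Lemma corner1_tailmx n (u : 'M[C]_n) : corner1 u *m tailmx n = tailmx n *m u.
Proof.
by rewrite mulmxDl delta_tailmx add0r -mulmxA tailmx_isometry mulmx1.
Qed.

Lemma corner1_adj n (u : 'M[C]_n) : (corner1 u)^t* = corner1 (u^t*).
Proof. by rewrite ctrmxD ctrmx_delta !ctrmxM trmxCK mulmxA. Qed.

Lemma corner1_unitary n (u : 'M[C]_n) :
  u \is unitarymx -> corner1 u \is unitarymx.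
Proof.
move=> uu; apply/unitarymxP; rewrite corner1_adj {2}/corner1 mulmxDr.
rewrite !mulmxA corner1_tailmx -(mulmxA _ u) (unitarymxP uu) mulmx1.
rewrite tailmx_range mulmxDl mul_delta_mx -!mulmxA tailmx_adj_delta.
by rewrite !mulmx0 addr0 addrC subrK.
Qed.

Lemma corner1_conj_delta0 n (u : 'M[C]_n) :
  corner1 u *m delta_mx 0 0 *m (corner1 u)^t* = delta_mx 0 0.
Proof.
have -> : corner1 u *m delta_mx 0 0 = delta_mx 0 0 :> 'M[C]_n.+1.
  by rewrite [LHS]mulmxDl mul_delta_mx -mulmxA tailmx_adj_delta mulmx0 addr0.
by rewrite corner1_adj [LHS]mulmxDr mul_delta_mx !mulmxA delta_tailmx !mul0mx addr0.
Qed.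

Lemma corner1_sandwich00 n (u : 'M[C]_n) (Y : 'M[C]_n.+1) :
  ((corner1 u)^t* *m Y *m corner1 u) 0 0 = Y 0 0.
Proof.
have cl : corner1 u *m delta_mx 0 0 = delta_mx 0 0 :> 'M[C]_n.+1.
  by rewrite [LHS]mulmxDl mul_delta_mx -mulmxA tailmx_adj_delta mulmx0 addr0.
have cr : delta_mx 0 0 *m (corner1 u)^t* = delta_mx 0 0 :> 'M[C]_n.+1.
  by rewrite -[delta_mx 0 0 in LHS]ctrmx_delta -ctrmxM cl ctrmx_delta.
have := delta_sandwich 0 0 0 0 ((corner1 u)^t* *m Y *m corner1 u).
rewrite -!mulmxA cl !mulmxA cr delta_sandwich => /matrixP/(_ 0 0).
by rewrite !scalemxE !mxE !eqxx !mulr1.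
Qed.

(** A conjugation chosen for the compressed map can be performed on the whole
    map. *)
Lemma compression_corner1 n (u : 'M[C]_n) Phi A :
  compression (tailmx n) (compression (corner1 u) Phi) A =
  compression u (compression (tailmx n) Phi) A.
Proof. by rewrite !compression_comp corner1_tailmx. Qed.

End Corner.

(** * Fixed points and spectral projections *)

Section FixedPoints.
Variable C : numClosedFieldType.
Implicit Types n : nat.

Lemma fixed_scalar_or_not n (Phi : 'M[C]_n -> 'M[C]_n) :
  (forall X, Phi X = X -> is_scalar_mx X) \/
  exists2 X, Phi X = X & ~~ is_scalar_mx X.
Proof.
have [[X PX nX]|noX] := EM (exists2 X, Phi X = X & ~~ is_scalar_mx X).
  by right; exists X.
by left=> X PX; apply: contrapT => /negP nX; apply: noX; exists X.
Qed.

(** The fixed space is closed under adjoints, so the real or the imaginary part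
    of [X] is a non-scalar fixed Hermitian matrix, which the spectral theorem
    diagonalises. *)
Lemma nonscalar_fixed_diag n (Phi : {linear 'M[C]_n -> 'M[C]_n}) X :
  (forall A, Phi (A^t*) = (Phi A)^t*) -> Phi X = X -> ~~ is_scalar_mx X ->
  exists2 U : 'M[C]_n, U \is unitarymx & exists2 d : 'rV[C]_n,
    compression U Phi (diag_mx d) = diag_mx d & exists i j, d 0 i != d 0 j.
Proof.
move=> adjPhi PX nX.
have [H [Hadj PH nH]] :
    exists H, [/\ H^t* = H, Phi H = H & ~~ is_scalar_mx H].
  pose H1 := X + X^t*; pose H2 := 'i *: (X - X^t*).
  have [/is_scalar_mxP[a H1a]|nH1] := boolP (is_scalar_mx H1); last first.
    by exists H1; rewrite ctrmxD trmxCK addrC linearD /= adjPhi PX.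
  exists H2; split; last 1 first.
  - apply: contra nX => /is_scalar_mxP[b H2b].
    apply/is_scalar_mxP; exists (2^-1 * (a + - 'i * b)).
    rewrite -scale_scalar_mx raddfD /= -scale_scalar_mx -H2b -H1a.
    rewrite scalerA mulNr -expr2 sqrCi opprK scale1r.
    rewrite addrACA subrr addr0 -mulr2n -scaler_nat scalerA.
    by rewrite mulVf ?scale1r // pnatr_eq0.
  - by rewrite ctrmxZ conjCi ctrmxB trmxCK scaleNr -scalerN opprB.
  - by rewrite linearZ linearB /= adjPhi PX.
have /hermitian_normalmx/orthomx_spectralP : H \is hermsymmx.
  by apply/is_hermitianmxP; rewrite expr0 scale1r Hadj.
have Pu := spectral_unitarymx H; rewrite (invmx_unitary Pu).
set P := spectralmx H in Pu *; set d := spectral_diag H => defH.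
exists (P^t*); first by rewrite trmxC_unitary.
exists d.
  rewrite /compression trmxCK -defH PH {1}defH.
  by rewrite unitary_conjVK.
apply: contrapT => dE; case/negP: nH; apply/is_scalar_mxP.
have dE' i j : d 0 i = d 0 j.
  by apply/eqP/negPn/negP => nij; apply: dE; exists i, j.
rewrite defH; case: (pickP (@predT 'I_n)) => [i0 _|noI]; last first.
  by exists 0; apply/matrixP => i; have := noI i.
have dM : diag_mx d = (d 0 i0)%:M.
  by apply/matrixP => k l; rewrite !mxE (dE' k i0).
exists (d 0 i0); rewrite dM mul_mx_scalar -scalemxAl.
by rewrite unitarymx_adj_mul // scalemx1.
Qed.

(** Spectral projections are polynomials in the matrix, and the fixed points
    form an algebra.  The polynomial is the Lagrange interpolation product
    [f s], with [s] the list of the eigenvalues different from [d 0 i]. *)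
Lemma faithful_fixed_spectral n (Phi : {linear 'M[C]_n -> 'M[C]_n}) d i :
  schwarz_idem Phi -> faithful_map Phi -> Phi (diag_mx d) = diag_mx d ->
  let p := diag_mx (\row_k (d 0 k == d 0 i)%:R) in Phi p = p.
Proof.
move=> [schPhi idPhi] faith Pd.
pose f (s : seq C) : 'rV[C]_n :=
  \row_k \prod_(c <- s) ((d 0 k - c) / (d 0 i - c)).
have diag1 : diag_mx (const_mx 1) = 1%:M :> 'M[C]_n.
  by apply/matrixP => k l; rewrite !mxE.
have Pf s : Phi (diag_mx (f s)) = diag_mx (f s).
  elim: s => [|c s IHs].
    have -> : f [::] = const_mx 1 by apply/rowP => k; rewrite !mxE big_nil.
    by rewrite diag1; case: schPhi.
  pose g : 'rV[C]_n := (d 0 i - c)^-1 *: (d - c *: const_mx 1).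
  have -> : diag_mx (f (c :: s)) = diag_mx g *m diag_mx (f s).
    rewrite mulmx_diag; congr diag_mx; apply/rowP => k.
    by rewrite !mxE big_cons mulr1 [_^-1 * _]mulrC.
  rewrite faithful_fixed_mul // ?IHs //.
  have -> : diag_mx g = (d 0 i - c)^-1 *: (diag_mx d - c *: 1%:M).
    apply/matrixP => k l; rewrite !mxE.
    by case: (k == l); rewrite ?mulr1n ?mulr0n ?mulr0 ?subr0 ?mulr0.
  by rewrite linearZ linearB /= linearZ /= Pd; case: schPhi => ->.
move=> /=; have -> : \row_k (d 0 k == d 0 i)%:R =
  f [seq c <- [seq d 0 k | k <- enum 'I_n] | c != d 0 i] :> 'rV[C]_n.
  apply/rowP => k; rewrite !mxE.
  have [->|ki] := eqVneq (d 0 k) (d 0 i).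
    rewrite big_seq big1 // => c; rewrite mem_filter => /andP[ci _].
    by rewrite divff // subr_eq0 eq_sym.
  rewrite (big_rem (d 0 k)) /= ?subrr ?mul0r //.
  by rewrite mem_filter ki map_f // mem_enum.
exact: Pf.
Qed.

(** Both projections being in the multiplicative domain, [Phi] commutes with the
    cutting out of entry [(i, j)], so it acts on that entry as a scalar. *)
Lemma schur_multiplier n (Phi : {linear 'M[C]_n -> 'M[C]_n}) i j :
  schwarz Phi ->
  Phi (delta_mx i i) = delta_mx i i -> Phi (delta_mx j j) = delta_mx j j ->
  forall A, Phi A i j = Phi (delta_mx i j) i j * A i j.
Proof.
move=> schPhi Pi Pj A.
have /matrixP/(_ i j) : Phi (delta_mx i i *m A *m delta_mx j j) =
                        delta_mx i i *m Phi A *m delta_mx j j.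
  by rewrite schwarz_fixed_projr ?schwarz_fixed_projl // ?ctrmx_delta ?mul_delta_mx.
rewrite !delta_sandwich linearZ /= !scalemxE [delta_mx i j i j]mxE !eqxx mulr1 => <-.
by rewrite mulrC.
Qed.

Lemma schur_coef_idem n (Phi : {linear 'M[C]_n -> 'M[C]_n}) i j :
  schwarz_idem Phi ->
  Phi (delta_mx i i) = delta_mx i i -> Phi (delta_mx j j) = delta_mx j j ->
  Phi (delta_mx i j) i j = 0 \/ Phi (delta_mx i j) i j = 1.
Proof.
move=> [schPhi idPhi] Pi Pj.
have := schur_multiplier schPhi Pi Pj (Phi (delta_mx i j)).
have /= -> := idPhi (delta_mx i j) => /eqP; rewrite -subr_eq0 -{1}[Phi _ i j]mulr1.
by rewrite -mulrBr mulf_eq0 subr_eq0 => /orP[]/eqP; [left | right].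
Qed.

Lemma schur_coefC n (Phi : {linear 'M[C]_n -> 'M[C]_n}) i j :
  schwarz Phi -> Phi (delta_mx j i) j i = (Phi (delta_mx i j) i j)^*.
Proof.
by case=> _ adjPhi _; rewrite -ctrmxE -adjPhi ctrmx_delta.
Qed.

Lemma schur_perm n (Phi : {linear 'M[C]_n -> 'M[C]_n}) (s : 'S_n) m :
  (forall A i j, Phi A i j = m i j * A i j) ->
  forall A i j, compression (perm_mx s) Phi A i j =
    m (s^-1 i)%g (s^-1 j)%g * A i j.
Proof.
by move=> PE A i j; rewrite perm_mx_conjVE PE perm_mx_conjE !permKV.
Qed.

Lemma offdiag_sym n (Phi : 'M[C]_n -> 'M[C]_n) i j :
  schwarz Phi -> (forall A, Phi A i j = 0) -> forall A, Phi A j i = 0.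
Proof.
case=> _ adjPhi _ Pij A.
by rewrite -[A]trmxCK adjPhi ctrmxE Pij conjC0.
Qed.

End FixedPoints.

(** * Annihilating or fixing the first diagonal unit *)

Section CornerCompression.
Variable C : numClosedFieldType.

(** By [schwarz_gram_eq0] the map annihilates the first row, and by taking
    adjoints the first column, of every matrix. *)
Lemma kills_delta0_compress n (Phi : {linear 'M[C]_n.+1 -> 'M[C]_n.+1}) A :
  schwarz Phi -> Phi (delta_mx 0 0) = 0 ->
  Phi (tailmx C n *m ((tailmx C n)^t* *m A *m tailmx C n) *m (tailmx C n)^t*) =
  Phi A.
Proof.
move=> schPhi P0; pose e : 'M[C]_n.+1 := delta_mx 0 0.
have eadj : e^t* = e by rewrite ctrmx_delta.
have ee : e *m e = e by rewrite mul_delta_mx.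
have Pl X : Phi (e *m X) = 0.
  rewrite -eadj; apply: schwarz_gram_eq0 => //.
  by rewrite eadj ee.
have Pr X : Phi (X *m e) = 0.
  rewrite -[X in Phi X]trmxCK ctrmxM eadj; case: (schPhi) => _ -> _.
  by rewrite Pl ctrmx0.
have -> : tailmx C n *m ((tailmx C n)^t* *m A *m tailmx C n) *m (tailmx C n)^t* =
  A - e *m A - (A - e *m A) *m e.
  rewrite !mulmxA tailmx_range -(mulmxA _ (tailmx C n)) tailmx_range.
  by rewrite mulmxBr mulmx1 mulmxBl mul1mx.
by rewrite !linearB /= Pl Pr !subr0.
Qed.

Section KilledCorner.
Variables (n : nat) (Psi : {linear 'M[C]_n.+1 -> 'M[C]_n.+1}).
Hypothesis idemPsi : schwarz_idem Psi.
Hypothesis Psi0 : Psi (delta_mx 0 0) = 0.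
Let t := tailmx C n.
Let E := compression t Psi.

Let Pkill A : Psi (t *m (t^t* *m A *m t) *m t^t*) = Psi A.
Proof. by apply: kills_delta0_compress => //; case: idemPsi. Qed.

Lemma kills_compress A : t^t* *m Psi A *m t = E (t^t* *m A *m t).
Proof. by rewrite /E /compression Pkill. Qed.

Lemma kills_idem : schwarz_idem E.
Proof.
apply: compression_schwarz_idem => //; first exact: tailmx_isometry.
by move=> A; rewrite -[in RHS]Pkill !mulmxA.
Qed.

(** By idempotence [Phi] may be applied twice, and the second application only
    sees the compression of the result of the first. *)
Lemma kills_factor A : Psi A = Psi (t *m E (t^t* *m A *m t) *m t^t*).
Proof.
rewrite -kills_compress Pkill.
by case: idemPsi => _ idPsi; have /= -> := idPsi A.
Qed.

Lemma kills_unit : Psi (t *m t^t*) = 1%:M.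
Proof.
have := Pkill 1%:M; rewrite mulmx1 tailmx_isometry mulmx1 => ->.
by case: idemPsi => [[]].
Qed.

(** Where the compression is multiplicative, the Schwarz inequality for [Psi] is
    an equality on the last coordinates up to the contribution of the first
    row, which must therefore vanish. *)
Lemma kills_offdiag A j :
  (let B := E (t^t* *m A *m t) in E (B^t* *m B) = B^t* *m B) ->
  Psi A 0 (lift ord0 j) = 0.
Proof.
move=> /=; set B := E (t^t* *m A *m t) => EB.
have [[_ _ Psch] idPsi] := idemPsi.
have tt : t^t* *m t = 1%:M by apply: tailmx_isometry.
have /(psdmx_sandwich t)/psdmx_entry/(_ j) := Psch (t *m B *m t^t*).
rewrite mulmxBr mulmxBl addmxE oppmxE.
have -> : (t *m B *m t^t*)^t* *m (t *m B *m t^t*) = t *m (B^t* *m B) *m t^t*.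
  by rewrite !ctrmxM trmxCK !mulmxA -[_ *m t^t* *m t]mulmxA tt mulmx1.
have -> : Psi (t *m B *m t^t*) = Psi A by rewrite -kills_factor.
rewrite (_ : t^t* *m Psi (t *m _ *m _) *m t = E (B^t* *m B)) // EB.
rewrite compress_gram.
rewrite -/t kills_compress -/B opprD addrCA subrr addr0 oppr_ge0 => le0.
by apply/eqP; rewrite -mul_conjC_eq0 mulrC eq_le le0 mulrC mul_conjC_ge0.
Qed.

Lemma kills_entry A i j :
  Psi A (lift ord0 i) (lift ord0 j) = E (t^t* *m A *m t) i j.
Proof. by rewrite -kills_compress tailmx_compress. Qed.

End KilledCorner.

Section FixedCorner.
Variables (n : nat) (Psi : {linear 'M[C]_n.+1 -> 'M[C]_n.+1}).
Hypothesis idemPsi : schwarz_idem Psi.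
Hypothesis Psi0 : Psi (delta_mx 0 0) = delta_mx 0 0.
Let t := tailmx C n.
Let E := compression t Psi.
Let q := t *m t^t*.

Let tt : t^t* *m t = 1%:M.
Proof. exact: tailmx_isometry. Qed.

Lemma fixes_tail_proj : [/\ q^t* = q, q *m q = q & Psi q = q].
Proof.
split; first by rewrite /q ctrmxM trmxCK.
  by rewrite /q mulmxA -(mulmxA t) tt mulmx1.
rewrite /q tailmx_range linearB /= Psi0.
by case: idemPsi => [[-> _ _] _].
Qed.

Let Pqq A : Psi (q *m A *m q) = q *m Psi A *m q.
Proof.
case: idemPsi => schPsi _; case: fixes_tail_proj => qadj qq Pq.
by rewrite (schwarz_fixed_projr schPsi) // (schwarz_fixed_projl schPsi).
Qed.

Lemma fixes_idem : schwarz_idem E.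
Proof.
apply: compression_schwarz_idem => // A; rewrite -/q Pqq !mulmxA tt mul1mx.
by rewrite -(mulmxA _ (t^t*)) tt mulmx1.
Qed.

(** The complementary projection [q] is fixed too, so [Psi] commutes with the
    compression to the last coordinates. *)
Lemma fixes_extend B : Psi (t *m B *m t^t*) = t *m E B *m t^t*.
Proof.
have -> : t *m B *m t^t* = q *m (t *m B *m t^t*) *m q.
  rewrite /q !mulmxA -(mulmxA t (t^t*) t) tt mulmx1.
  by rewrite -(mulmxA _ (t^t*) t) tt mulmx1.
by rewrite Pqq /E /compression /q !mulmxA.
Qed.

Lemma fixes_compress A : t^t* *m Psi A *m t = E (t^t* *m A *m t).
Proof.
rewrite /E /compression.
have -> : t *m (t^t* *m A *m t) *m t^t* = q *m A *m q by rewrite /q !mulmxA.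
by rewrite Pqq /q !mulmxA tt mul1mx -(mulmxA _ (t^t*) t) tt mulmx1.
Qed.

Lemma fixes_delta : (forall i, E (delta_mx i i) = delta_mx i i) ->
  forall i, Psi (delta_mx i i) = delta_mx i i.
Proof.
move=> Ee i; have [j ->|-> //] := unliftP 0 i.
by rewrite -tailmx_delta fixes_extend Ee.
Qed.

End FixedCorner.

End CornerCompression.

(** * Idempotent Schwarz maps on 2 x 2 matrices *)

Section LowDimension.
Variable C : numClosedFieldType.

(** The bundled linear functional through which states are read off from maps;
    [V] allows its argument to live on a subspace. *)
Definition diag_entry m n p (V : 'M[C]_(m, p)) (Phi : {linear 'M[C]_m -> 'M[C]_n})
    i (A : 'M[C]_p) : C := Phi (V *m A *m V^t*) i i.

Fact diag_entry_is_scalar m n p (V : 'M[C]_(m, p))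
    (Phi : {linear 'M[C]_m -> 'M[C]_n}) i : scalar (diag_entry V Phi i).
Proof.
move=> a A B; rewrite /diag_entry mulmxDr mulmxDl -scalemxAr -scalemxAl.
by rewrite linearP addmxE scalemxE.
Qed.
HB.instance Definition _ m n p V Phi i :=
  GRing.isLinear.Build C 'M[C]_p C *%R (@diag_entry m n p V Phi i)
    (@diag_entry_is_scalar m n p V Phi i).

Lemma diag_entry_ge0 n p (V : 'M[C]_(n, p)) (Phi : {linear 'M[C]_n -> 'M[C]_n}) i :
  schwarz Phi -> forall A, psdmx A -> 0 <= diag_entry V Phi i A.
Proof.
move=> schPhi A pA; apply/psdmx_entry/schwarz_pos => //.
by have := psdmx_sandwich (V^t*) pA; rewrite trmxCK.
Qed.

Lemma ord2P (P : 'I_2 -> Prop) : P 0 -> P 1 -> forall i, P i.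
Proof.
move=> P0 P1 i; have [j ->|->] // := unliftP 0 i.
by rewrite (ord1 j) (_ : lift _ _ = 1) //; apply: val_inj.
Qed.

(** If only scalars are fixed, the map is a state times the identity, and the
    state can be diagonalised.  If the map annihilates the first diagonal unit,
    it is the second diagonal entry times the identity.  Otherwise it is
    faithful with a non-scalar fixed point, whose two spectral projections may
    be taken to be the diagonal units; the map then multiplies the off-diagonal
    entries by a common scalar, equal to 0 or 1. *)
Lemma schwarz_idem_M2 (E : {linear 'M[C]_2 -> 'M[C]_2}) : schwarz_idem E ->
  exists2 u : 'M[C]_2, u \is unitarymx &
  [\/ exists2 d : 'I_2 -> C, (forall i, 0 <= d i) &
        forall A, compression u E A = (\sum_i d i * A i i) *: 1%:M,
      forall A i j, compression u E A i j = A i j *+ (i == j) |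
      forall A, compression u E A = A].
Proof.
move=> idemE; have [schE idE] := idemE; have [uE adjE _] := schE.
have [all_scalar|[X EX nX]] := fixed_scalar_or_not E.
  have EA A : E A = diag_entry 1%:M E 0 A *: 1%:M.
    have /all_scalar/is_scalar_mxP[a Ea] := idE A.
    by rewrite /diag_entry ctrmx1 mul1mx mulmx1 Ea mxE eqxx mulr1n scalemx1.
  have [u uu [d d0 dE]] :=
    positive_functional_diag (diag_entry_ge0 1%:M 0 schE).
  exists u => //; constructor 1; exists d => // A.
  by rewrite /compression EA dE -scalemxAr mulmx1 -scalemxAl unitarymx_adj_mul.
have [faith|[u uu Eu0]] := faithful_or_kills schE; last first.
  exists u => //; constructor 1; exists (fun i => (i == 1)%:R) => [i|A].
    exact: ler0n.
  have [schF _] := compression_unitary_idem uu idemE.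
  have tt1 : compression u E (tailmx C 1 *m (tailmx C 1)^t*) = 1%:M.
    have := kills_delta0_compress 1%:M schF Eu0.
    by rewrite mulmx1 tailmx_isometry mulmx1 => ->; case: schF.
  rewrite -(kills_delta0_compress A schF Eu0).
  set B := _ *m A *m _; have -> : B = A 1 1 *: 1%:M.
    rewrite [LHS]mx11_scalar scalemx1 tailmx_compress.
    by rewrite (_ : lift _ _ = 1) //; apply: val_inj.
  rewrite -scalemxAr mulmx1 -scalemxAl linearZ /= tt1.
  rewrite (bigD1 1) //= mul1r big1 ?addr0 // => i /negPf ->.
  by rewrite mul0r.
have [u uu [d ud [i0 [j0 dij]]]] := nonscalar_fixed_diag adjE EX nX.
have [schF idF] := compression_unitary_idem uu idemE.
have faithF := compression_unitary_faithful uu faith.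
have Fe i : compression u E (delta_mx i i) = delta_mx i i.
  have := faithful_fixed_spectral i (conj schF idF) faithF ud.
  rewrite (_ : \row_k _ = delta_mx 0 i) ?diag_mx_delta //.
  apply/rowP => k; rewrite !mxE eqxx /=; congr (_%:R).
  have d01 : d 0 0 != d 0 1.
    apply: contra dij => /eqP d01; move: i0 j0.
    by do 2![apply: ord2P]; rewrite ?d01.
  move: i k; do 2![apply: ord2P]; rewrite ?eqxx // ?(negPf d01) //.
  by rewrite eq_sym (negPf d01).
have Fschur := schur_multiplier schF (Fe _) (Fe _).
exists u => //.
have [m0|m1] := schur_coef_idem (conj schF idF) (Fe 0) (Fe 1).
  constructor 2 => A; apply: ord2P; apply: ord2P; rewrite Fschur /=.
  - by rewrite Fe mxE !eqxx mul1r.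
  - by rewrite m0 mul0r.
  - by rewrite schur_coefC // m0 conjC0 mul0r.
  - by rewrite Fe mxE !eqxx mul1r.
constructor 3 => A; apply/matrixP; apply: ord2P; apply: ord2P; rewrite Fschur /=.
- by rewrite Fe mxE !eqxx mul1r.
- by rewrite m1 mul1r.
- by rewrite schur_coefC // m1 conjC1 mul1r.
- by rewrite Fe mxE !eqxx mul1r.
Qed.

End LowDimension.

(** * The standard forms on 3 x 3 matrices *)

Section StandardForms.
Variable C : numClosedFieldType.

Definition mix (l : C) (A : 'M[C]_3) := l * entry A 2 2 + (1 - l) * entry A 3 3.

(** The weights are taken in the complex field, where [0 <= l] already makes [l]
    real. *)
Inductive standard_form (Psi : 'M[C]_3 -> 'M[C]_3) : Prop :=
| FormI l of 0 <= l <= 1 & (forall A, Psi A = mix l A *: 1%:M)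
| FormII l of 0 <= l <= 1 & (forall A, Psi A =
    mx3 [:: [:: mix l A    ; 0          ; 0          ];
            [:: 0          ; entry A 2 2; 0          ];
            [:: 0          ; 0          ; entry A 3 3]])
| FormIII l of 0 <= l <= 1 & (forall A, Psi A =
    mx3 [:: [:: mix l A    ; 0          ; 0          ];
            [:: 0          ; entry A 2 2; entry A 2 3];
            [:: 0          ; entry A 3 2; entry A 3 3]])
| FormIV of (forall A, Psi A =
    mx3 [:: [:: entry A 1 1; 0          ; 0          ];
            [:: 0          ; entry A 2 2; 0          ];
            [:: 0          ; 0          ; entry A 3 3]])
| FormV of (forall A, Psi A =
    mx3 [:: [:: entry A 1 1; 0          ; 0          ];
            [:: 0          ; entry A 2 2; entry A 2 3];
            [:: 0          ; entry A 3 2; entry A 3 3]])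
| FormVI l of 0 < l < 1 & (forall A, Psi A =
    mx3 [:: [:: entry A 1 1; 0          ; 0          ];
            [:: 0          ; mix l A    ; 0          ];
            [:: 0          ; 0          ; mix l A    ]])
| FormVII of (forall A, Psi A = A).

Local Notation i1 := (lift ord0 (0 : 'I_2) : 'I_3).
Local Notation i2 := (lift ord0 (1 : 'I_2) : 'I_3).

Lemma standard_form_compression (W : 'M[C]_3) (Psi : 'M[C]_3 -> 'M[C]_3) :
  W \is unitarymx ->
  (exists2 U : 'M[C]_3, U \is unitarymx &
     standard_form (compression U (compression W Psi))) ->
  exists2 U : 'M[C]_3, U \is unitarymx & standard_form (compression U Psi).
Proof.
move=> Wu [U Uu]; rewrite (funext (compression_comp W U Psi)) => std.
by exists (W *m U); first exact: mul_unitarymx.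
Qed.

Lemma inord3E :
  ((inord 0 : 'I_3) = 0) * ((inord 1 : 'I_3) = i1) * ((inord 2 : 'I_3) = i2).
Proof. by do !split; apply: val_inj; rewrite /= inordK. Qed.

Lemma ord3P (P : 'I_3 -> Prop) : P 0 -> P i1 -> P i2 -> forall i, P i.
Proof.
move=> P0 P1 P2 i; have [j ->|-> //] := unliftP 0 i.
by move: j; apply: ord2P.
Qed.

Lemma mx3_blockE (Y : 'M[C]_3) :
  (forall j, Y 0 (lift ord0 j) = 0) -> (forall i, Y (lift ord0 i) 0 = 0) ->
  Y = mx3 [:: [:: Y 0 0; 0 ; 0]; [:: 0 ; Y i1 i1; Y i1 i2];
              [:: 0 ; Y i2 i1; Y i2 i2]].
Proof.
move=> Y0 Y0'; apply/matrixP.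
by do 2![apply: ord3P]; rewrite mxE /= ?Y0 ?Y0'.
Qed.

Lemma sum_ord2 (F : 'I_2 -> C) : \sum_i F i = F 0 + F 1.
Proof.
rewrite !big_ord_recl big_ord0 addr0; congr (_ + F _); exact: val_inj.
Qed.

Lemma mix_tail (d : 'I_2 -> C) (A : 'M[C]_3) : d 0 + d 1 = 1 ->
  \sum_i d i * A (lift ord0 i) (lift ord0 i) = mix (d 0) A.
Proof.
by move=> d1; rewrite sum_ord2 /mix /entry /= !inord3E -d1 addrAC subrr add0r.
Qed.

Lemma scalar_weights (E : 'M[C]_2 -> 'M[C]_2) (d : 'I_2 -> C) : unital E ->
  (forall A, E A = (\sum_i d i * A i i) *: 1%:M) -> d 0 + d 1 = 1.
Proof.
move=> /(congr1 (fun B : 'M[C]_2 => B 0 0)) + EA.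
by rewrite EA scalemxE sum_ord2 !mxE !eqxx !mulr1.
Qed.

Lemma weights_unit_interval (d : 'I_2 -> C) :
  (forall i, 0 <= d i) -> d 0 + d 1 = 1 -> 0 <= d 0 <= 1.
Proof. by move=> d0 d1; rewrite d0 -d1 lerDl d0. Qed.

Lemma kills_scalar (Psi : {linear 'M[C]_3 -> 'M[C]_3}) (d : 'I_2 -> C) :
  schwarz_idem Psi -> Psi (delta_mx 0 0) = 0 -> (forall i, 0 <= d i) ->
  (forall A, compression (tailmx C 2) Psi A = (\sum_i d i * A i i) *: 1%:M) ->
  standard_form Psi.
Proof.
move=> idemPsi Psi0 d0 EA; have [[uE _ _] _] := kills_idem idemPsi Psi0.
have d1 := scalar_weights uE EA.
apply: (FormI (weights_unit_interval d0 d1)) => A.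
rewrite (kills_factor idemPsi Psi0) EA -scalemxAr mulmx1 -scalemxAl linearZ /=.
rewrite (kills_unit idemPsi Psi0).
congr (_ *: _); rewrite -mix_tail //.
by apply: eq_bigr => i _; rewrite tailmx_compress.
Qed.

(** Products of diagonal matrices are diagonal, so [kills_offdiag]
    applies.  The corner entry is a positive functional of the diagonal matrix
    produced by the compression, hence a convex combination of its entries. *)
Lemma kills_diag (Psi : {linear 'M[C]_3 -> 'M[C]_3}) :
  schwarz_idem Psi -> Psi (delta_mx 0 0) = 0 ->
  (forall A i j, compression (tailmx C 2) Psi A i j = A i j *+ (i == j)) ->
  standard_form Psi.
Proof.
set t := tailmx C 2; set E := compression t Psi => idemPsi Psi0 EA.
have Pj0 A j : Psi A 0 (lift ord0 j) = 0.
  apply: (kills_offdiag idemPsi Psi0) => /=; apply/matrixP => k l; rewrite EA.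
  have [->|kl] := eqVneq k l; first by rewrite mulr1n.
  rewrite mulr0n [RHS]mxE big1 // => r _; rewrite ctrmxE !EA.
  have [rk|_] := eqVneq r k; last by rewrite mulr0n conjC0 mul0r.
  by rewrite rk (negPf kl) mulr0n mulr0.
have schPsi : schwarz Psi by case: idemPsi.
pose d i := Psi (delta_mx (lift ord0 i) (lift ord0 i)) 0 0.
have d0 (i : 'I_2) : 0 <= d i.
  by apply/psdmx_entry/schwarz_pos => //; apply: psdmx_delta.
have P00 A : Psi A 0 0 = \sum_(i < 2) d i * A (lift ord0 i) (lift ord0 i).
  rewrite (kills_factor idemPsi Psi0) -/t -/E.
  have -> : t *m E (t^t* *m A *m t) *m t^t* = \sum_(i < 2)
     A (lift ord0 i) (lift ord0 i) *: delta_mx (lift ord0 i) (lift ord0 i).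
    rewrite [E _]matrix_sum_delta mulmx_sumr mulmx_suml; apply: eq_bigr => i _.
    rewrite (bigD1 i) //= big1 => [|k /negPf ki].
      rewrite addr0 EA eqxx mulr1n tailmx_compress -scalemxAr -scalemxAl.
      by rewrite tailmx_delta.
    by rewrite EA eq_sym ki mulr0n scale0r.
  rewrite linear_sum summxE; apply: eq_bigr => i _.
  by rewrite linearZ scalemxE mulrC.
have d1 : d 0 + d 1 = 1.
  have [/(congr1 (fun B : 'M[C]_3 => B 0 0)) + _ _] := schPsi.
  by rewrite P00 sum_ord2 !mxE !eqxx !mulr1.
apply: (FormII (weights_unit_interval d0 d1)) => A.
rewrite [LHS]mx3_blockE => [|//|i]; last exact: offdiag_sym.
rewrite P00 mix_tail // !(kills_entry idemPsi Psi0) !EA !tailmx_compress /=.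
by rewrite /entry !inord3E.
Qed.

(** The corner entry is a state of the lower block.  The conjugation that
    diagonalises this state does not disturb the compression, which is the
    identity map. *)
Lemma kills_id (Psi : {linear 'M[C]_3 -> 'M[C]_3}) :
  schwarz_idem Psi -> Psi (delta_mx 0 0) = 0 ->
  compression (tailmx C 2) Psi =1 id ->
  exists2 U : 'M[C]_3, U \is unitarymx & standard_form (compression U Psi).
Proof.
move=> idemPsi Psi0 EA; have [schPsi _] := idemPsi.
set t := tailmx C 2 in EA.
have [u uu [d d0 dE]] := positive_functional_diag (diag_entry_ge0 t 0 schPsi).
have cu := corner1_unitary uu.
exists (corner1 u) => //; set Phi := compression _ _.
have idemPhi : schwarz_idem Phi by apply: compression_unitary_idem.
have Phi0 : Phi (delta_mx 0 0) = 0.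
  by rewrite /Phi /compression corner1_conj_delta0 Psi0 mulmx0 mul0mx.
have EPhi A : compression t Phi A = A.
  by rewrite compression_corner1 /compression -/(compression t Psi _) EA unitary_conjK.
have P0j A j : Phi A 0 (lift ord0 j) = 0.
  by apply: kills_offdiag; rewrite //= !EPhi.
have P00 A : Phi A 0 0 = \sum_(i < 2) d i * A (lift ord0 i) (lift ord0 i).
  rewrite /Phi /compression corner1_sandwich00.
  rewrite -(kills_delta0_compress _ schPsi Psi0) -/t.
  have -> : t^t* *m (corner1 u *m A *m (corner1 u)^t*) *m t =
            u *m (t^t* *m A *m t) *m u^t*.
    rewrite corner1_adj -!mulmxA corner1_tailmx !mulmxA; congr (_ *m _ *m _ *m _).
    by rewrite -[corner1 u]trmxCK -ctrmxM corner1_adj corner1_tailmx ctrmxM trmxCK.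
  have /= := dE (t^t* *m A *m t); rewrite /diag_entry => ->.
  by apply: eq_bigr => i _; rewrite tailmx_compress.
have d1 : d 0 + d 1 = 1.
  have [[/(congr1 (fun B : 'M[C]_3 => B 0 0)) + _ _] _] := idemPhi.
  by rewrite P00 sum_ord2 !mxE !eqxx !mulr1.
apply: (FormIII (weights_unit_interval d0 d1)) => A.
rewrite [LHS]mx3_blockE => [|//|i]; last by apply: offdiag_sym; case: idemPhi.
rewrite P00 mix_tail // !(kills_entry idemPhi Phi0) !EPhi !tailmx_compress.
by rewrite /entry !inord3E.
Qed.

Lemma kills_standard (Psi : {linear 'M[C]_3 -> 'M[C]_3}) :
  schwarz_idem Psi -> Psi (delta_mx 0 0) = 0 ->
  exists2 U : 'M[C]_3, U \is unitarymx & standard_form (compression U Psi).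
Proof.
move=> idemPsi Psi0.
have [u uu uE] := schwarz_idem_M2 (kills_idem idemPsi Psi0).
have cu := corner1_unitary uu.
pose Phi := compression (corner1 u) Psi.
have idemPhi : schwarz_idem Phi by apply: compression_unitary_idem.
have Phi0 : Phi (delta_mx 0 0) = 0.
  by rewrite /Phi /compression corner1_conj_delta0 Psi0 mulmx0 mul0mx.
have EPhi : compression (tailmx C 2) Phi =1 compression u (compression (tailmx C 2) Psi).
  by move=> A; apply: compression_corner1.
case: uE => [[d d0 dE]|uE|uE].
- exists (corner1 u) => //.
  by apply: (kills_scalar idemPhi Phi0 d0) => A; rewrite EPhi dE.
- exists (corner1 u) => //.
  by apply: (kills_diag idemPhi Phi0) => A i j; rewrite EPhi uE.
apply: (standard_form_compression cu); apply: (kills_id idemPhi Phi0) => A.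
by rewrite EPhi uE.
Qed.

Lemma schur_pair_formV (Psi : 'M[C]_3 -> 'M[C]_3) m :
  (forall A i j, Psi A i j = m i j * A i j) ->
  (forall i, m i i = 1) -> (forall i j, m j i = (m i j)^*) ->
  m 0 i1 = 0 -> m 0 i2 = 0 -> m i1 i2 = 1 -> standard_form Psi.
Proof.
move=> PE m1 mC m01 m02 m12; apply: FormV => A.
have m0j j : m 0 (lift ord0 j) = 0 by move: j; apply: ord2P.
rewrite [LHS]mx3_blockE => [|j|j].
- by rewrite !PE !m1 m12 (mC i1 i2) m12 conjC1 !mul1r /entry !inord3E.
- by rewrite PE m0j mul0r.
- by rewrite PE mC m0j conjC0 mul0r.
Qed.

(** The coefficients [m i j] are 0 or 1.  Those equal to 1 mark the fixed matrix
    units; as the fixed points form a *-algebra, they define an equivalence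
    relation.  On three points it is discrete (IV), total (VII), or has a
    single pair, moved to the last two indices by a permutation (V). *)
Lemma schur_standard (Psi : {linear 'M[C]_3 -> 'M[C]_3}) :
  schwarz_idem Psi -> faithful_map Psi ->
  (forall i, Psi (delta_mx i i) = delta_mx i i) ->
  exists2 U : 'M[C]_3, U \is unitarymx & standard_form (compression U Psi).
Proof.
move=> [schPsi idPsi] faith Pe.
pose m i j := Psi (delta_mx i j) i j.
have PE A i j : Psi A i j = m i j * A i j.
  exact: (schur_multiplier schPsi (Pe i) (Pe j)).
have m01 i j : m i j = 0 \/ m i j = 1 by apply: schur_coef_idem.
have mC i j : m j i = (m i j)^* by apply: schur_coefC.
have m1 i : m i i = 1 by rewrite /m Pe mxE !eqxx.
have fixd i j : m i j = 1 -> Psi (delta_mx i j) = delta_mx i j.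
  move=> mij; apply/matrixP => k l; rewrite PE mxE.
  by case: andP => [[/eqP-> /eqP->]|_]; rewrite ?mij ?mulr1 ?mulr0.
have mT i j k : m i j = 1 -> m j k = 1 -> m i k = 1.
  move=> mij mjk; rewrite /m -(mul_delta_mx j i k).
  rewrite (faithful_fixed_mul schPsi idPsi faith) ?fixd // mul_delta_mx.
  by rewrite mxE !eqxx.
have mS i j : m i j = 1 -> m j i = 1 by move=> h; rewrite mC h conjC1.
have n10 : (1 : C) = 0 -> False by move/eqP; rewrite oner_eq0.
have perm_std (s : 'S_3) : m (s 0) (s i1) = 0 -> m (s 0) (s i2) = 0 ->
    m (s i1) (s i2) = 1 ->
    exists2 U : 'M[C]_3, U \is unitarymx & standard_form (compression U Psi).
  move=> h1 h2 h3; exists (perm_mx s^-1%g); first exact: perm_mx_unitary.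
  apply: (schur_pair_formV (m := fun i j => m (s i) (s j))) => //.
  by move=> A i j; rewrite (schur_perm s^-1%g PE) invgK.
have id_std : standard_form Psi ->
    exists2 U : 'M[C]_3, U \is unitarymx & standard_form (compression U Psi).
  move=> std; exists 1%:M; last by rewrite compression1.
  by apply/unitarymxP; rewrite ctrmx1 mulmx1.
case: (m01 0 i1) => a; case: (m01 0 i2) => b; case: (m01 i1 i2) => c.
- apply/id_std/FormIV => A; apply/matrixP; do 2![apply: ord3P];
    by rewrite PE !mxE /= /entry ?inord3E ?m1 ?a ?b ?c ?(mC 0) ?(mC i1 i2) ?a ?b ?c
      ?conjC0 ?mul1r ?mul0r.
- by apply: (perm_std 1%g); rewrite !perm1.
- apply: (perm_std (tperm 0 i1)); rewrite ?tpermL ?tpermR ?tpermD //.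
  by rewrite mC a conjC0.
- by case: n10; rewrite -(mT _ _ _ b (mS _ _ c)) a.
- apply: (perm_std (tperm 0 i2)); rewrite ?tpermL ?tpermR ?tpermD //.
  + by rewrite mC c conjC0.
  + by rewrite mC b conjC0.
  + by rewrite mC a conjC1.
- by case: n10; rewrite -(mT _ _ _ a c) b.
- by case: n10; rewrite -(mT _ _ _ (mS _ _ a) b) c.
apply/id_std/FormVII => A; apply/matrixP; do 2![apply: ord3P];
  by rewrite PE ?m1 ?(mC 0) ?(mC i1 i2) ?a ?b ?c ?conjC1 ?mul1r.
Qed.

(** The weights are positive because [Psi] is faithful.  For the first row
    [z] of [Psi A], off the diagonal: the matrix [Z] with this row only is
    fixed, hence so is [Z^* Z]; in the last coordinates the latter is both the
    rank one matrix [z^* z] and a scalar matrix, which forces [z = 0]. *)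
Lemma fixes_scalar (Psi : {linear 'M[C]_3 -> 'M[C]_3}) (d : 'I_2 -> C) :
  schwarz_idem Psi -> Psi (delta_mx 0 0) = delta_mx 0 0 -> faithful_map Psi ->
  (forall i, 0 <= d i) ->
  (forall A, compression (tailmx C 2) Psi A = (\sum_i d i * A i i) *: 1%:M) ->
  standard_form Psi.
Proof.
set t := tailmx C 2; set E := compression t Psi => idemPsi Psi0 faithPsi d0 EA.
have [schPsi idPsi] := idemPsi; have [[uE _ _] _] := fixes_idem idemPsi Psi0.
have d1 := scalar_weights uE EA.
have tt : t^t* *m t = 1%:M by apply: tailmx_isometry.
have PE B : Psi (t *m B *m t^t*) = t *m E B *m t^t* by apply: fixes_extend.
have compE A : t^t* *m Psi A *m t = E (t^t* *m A *m t).
  exact: fixes_compress.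
have dpos (i : 'I_2) : 0 < d i.
  rewrite lt_neqAle d0 andbT eq_sym; apply/eqP => di.
  have Pi : Psi (delta_mx (lift ord0 i) (lift ord0 i)) = 0.
    rewrite -tailmx_delta PE EA (bigD1 i) //= di mul0r add0r.
    rewrite big1 => [|k /negPf ki]; last by rewrite mxE ki mulr0.
    by rewrite scale0r mulmx0 mul0mx.
  have /matrixP/(_ (lift ord0 i) (lift ord0 i))/eqP := faithPsi _ (psdmx_delta _) Pi.
  by rewrite !mxE !eqxx oner_eq0.
have P0j A j : Psi A 0 (lift ord0 j) = 0.
  pose e : 'M[C]_3 := delta_mx 0 0.
  have eadj : e^t* = e by rewrite ctrmx_delta.
  have ee : e *m e = e by rewrite mul_delta_mx.
  pose q := t *m t^t*; pose Z := e *m Psi A *m q.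
  have PZ : Psi Z = Z.
    have [qadj qq Pq] := fixes_tail_proj idemPsi Psi0.
    rewrite (schwarz_fixed_projr schPsi) // (schwarz_fixed_projl schPsi) //.
    by have /= -> := idPsi A.
  pose B := t^t* *m (Z^t* *m Z) *m t.
  have EB : E B = B.
    by rewrite /B -compE (faithful_fixed_gram schPsi idPsi faithPsi).
  pose z k := Psi A 0 (lift ord0 k).
  have BE k l : B k l = (z k)^* * z l.
    pose W : 'rV[C]_2 := delta_mx 0 0 *m (Psi A *m t).
    have W0 r : W 0 r = z r by rewrite /W -rowE mxE mulmx_tail.
    have Zt : Z *m t = delta_mx 0 0 *m W.
      by rewrite /Z /W /q -!mulmxA tt mulmx1 !mulmxA mul_delta_mx.
    have -> : B = W^t* *m W.
      have -> : B = (Z *m t)^t* *m (Z *m t) by rewrite ctrmxM /B !mulmxA.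
      rewrite Zt ctrmxM ctrmx_delta -mulmxA (mulmxA (delta_mx 0 0)).
      by rewrite mul_delta_mx -rowE; congr (_ *m _); apply/rowP => r; rewrite mxE.
    by rewrite mxE big_ord1 ctrmxE !W0.
  have [rho Brho] : exists rho, B = rho *: 1%:M.
    by exists (\sum_i d i * B i i); rewrite -EA EB.
  have B01 : (z 0)^* * z 1 = 0 by rewrite -BE Brho scalemxE mxE mulr0.
  have B00 k : (z k)^* * z k = rho by rewrite -BE Brho scalemxE mxE eqxx mulr1.
  have zk k : z k = 0 -> rho = 0 by move=> zk; rewrite -(B00 k) zk mulr0.
  have rho0 : rho = 0.
    move/eqP: B01; rewrite mulf_eq0 conjC_eq0.
    by case/orP => /eqP/zk.
  by apply/eqP; rewrite -[Psi A _ _]/(z j) -mul_conjC_eq0 mulrC B00 rho0.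
apply: (@FormVI _ (d 0)); first by rewrite dpos -d1 ltrDl dpos.
move=> A.
rewrite [LHS]mx3_blockE => [|//|i]; last by apply: offdiag_sym.
have P00 : Psi A 0 0 = A 0 0.
  by rewrite (schur_multiplier schPsi Psi0 Psi0) Psi0 mxE !eqxx mul1r.
have Pij i j : Psi A (lift ord0 i) (lift ord0 j) = mix (d 0) A *+ (i == j).
  rewrite -tailmx_compress compE EA scalemxE mxE mulr_natr.
  rewrite -mix_tail //; congr (_ *+ _); apply: eq_bigr => k _.
  by rewrite tailmx_compress.
by rewrite P00 !Pij /entry !inord3E.
Qed.

Lemma fixes_standard (Psi : {linear 'M[C]_3 -> 'M[C]_3}) :
  schwarz_idem Psi -> faithful_map Psi ->
  Psi (delta_mx 0 0) = delta_mx 0 0 ->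
  exists2 U : 'M[C]_3, U \is unitarymx & standard_form (compression U Psi).
Proof.
move=> idemPsi faith Psi0.
have [u uu uE] := schwarz_idem_M2 (fixes_idem idemPsi Psi0).
have cu := corner1_unitary uu.
pose Phi := compression (corner1 u) Psi.
have idemPhi : schwarz_idem Phi by apply: compression_unitary_idem.
have faithPhi : faithful_map Phi by apply: compression_unitary_faithful.
have Phi0 : Phi (delta_mx 0 0) = delta_mx 0 0.
  rewrite /Phi /compression corner1_conj_delta0 Psi0.
  by rewrite -{1}(corner1_conj_delta0 u) unitary_conjK.
have EPhi : compression (tailmx C 2) Phi =1 compression u (compression (tailmx C 2) Psi).
  by move=> A; apply: compression_corner1.
have schur_std : (forall i : 'I_2, compression u (compression (tailmx C 2) Psi)
      (delta_mx i i) = delta_mx i i) ->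
    exists2 U : 'M[C]_3, U \is unitarymx & standard_form (compression U Psi).
  move=> Ee; apply: (standard_form_compression cu); apply: schur_standard => //.
  by apply: (fixes_delta idemPhi Phi0) => i; rewrite EPhi Ee.
case: uE => [[d d0 dE]|uE|uE].
- exists (corner1 u) => //.
  by apply: (fixes_scalar idemPhi Phi0 faithPhi d0) => A; rewrite EPhi dE.
- apply: schur_std => i; apply/matrixP => k l; rewrite uE mxE.
  have [->|kl] := eqVneq k l; first by rewrite mulr1n.
  rewrite mulr0n; case: eqP => [ki|//]; case: eqP => [li|//].
  by case/eqP: kl; rewrite ki li.
- by apply: schur_std => i; apply: uE.
Qed.

(** The case division: not faithful, faithful with scalar fixed points only, or
    faithful with a non-scalar fixed point.  In the last case a spectral
    projection of rank one is fixed. *)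
Lemma schwarz_idem_M3 (Phi : {linear 'M[C]_3 -> 'M[C]_3}) : schwarz_idem Phi ->
  (faithful_map Phi /\ forall A, Phi A = Phi A 0 0 *: 1%:M) \/
  exists2 U : 'M[C]_3, U \is unitarymx & standard_form (compression U Phi).
Proof.
move=> idemPhi; have [schPhi idPhi] := idemPhi.
have [faith|[U Uu U0]] := faithful_or_kills schPhi; last first.
  right; apply: (standard_form_compression Uu).
  exact: (kills_standard (compression_unitary_idem Uu idemPhi)).
have [all_scalar|[X PX nX]] := fixed_scalar_or_not Phi.
  left; split=> // A; have /all_scalar/is_scalar_mxP[a Ea] := idPhi A.
  by move: Ea => /= ->; rewrite mxE eqxx mulr1n scalemx1.
right; have [_ adjPhi _] := schPhi.
have [U Uu [d Ud [i0 [j0 dij]]]] := nonscalar_fixed_diag adjPhi PX nX.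
have idemU := compression_unitary_idem Uu idemPhi.
have faithU := compression_unitary_faithful Uu faith.
(* Among three eigenvalues that are not all equal, one is simple. *)
have [i iso] : exists i, forall k, (d 0 k == d 0 i) = (k == i).
  have [e01|n01] := eqVneq (d 0 0) (d 0 i1).
    exists i2; suff n02 : d 0 0 != d 0 i2.
      by apply: ord3P; rewrite ?eqxx -?e01 ?(negPf n02).
    apply: contra dij => /eqP e02; move: i0 j0.
    by do 2![apply: ord3P]; rewrite -?e01 -?e02.
  have [e02|n02] := eqVneq (d 0 0) (d 0 i2).
    by exists i1; apply: ord3P; rewrite ?eqxx -?e02 ?(negPf n01).
  by exists 0; apply: ord3P; rewrite ?eqxx // eq_sym ?(negPf n01) ?(negPf n02).
have Ui : compression U Phi (delta_mx i i) = delta_mx i i.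
  have := faithful_fixed_spectral i idemU faithU Ud.
  rewrite (_ : \row_k _ = delta_mx 0 i) ?diag_mx_delta //.
  by apply/rowP => k; rewrite !mxE eqxx iso.
pose P : 'M[C]_3 := perm_mx (tperm 0 i).
have Pu : P \is unitarymx by apply: perm_mx_unitary.
have P0 : compression P (compression U Phi) (delta_mx 0 0) = delta_mx 0 0.
  rewrite {1}/compression.
  have PdP : P *m delta_mx 0 0 *m P^t* = delta_mx i i.
    by rewrite perm_conj_delta tpermV tpermL.
  by rewrite PdP Ui -PdP unitary_conjK.
apply/(standard_form_compression Uu)/(standard_form_compression Pu).
apply: fixes_standard => //.
  exact: compression_unitary_idem.
exact: compression_unitary_faithful.
Qed.

End StandardForms.

(** * The standard forms are completely positive idempotents *)

Section Converse.
Variable C : numClosedFieldType.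
Local Notation i1 := (lift ord0 (0 : 'I_2) : 'I_3).
Local Notation i2 := (lift ord0 (1 : 'I_2) : 'I_3).

(** [ucp_idempotent] for maps that do not come with a proof of linearity, such as
    the standard forms. *)
Definition ucp_idempotent_fun n (Psi : 'M[C]_n -> 'M[C]_n) : Prop :=
  [/\ unital Psi, completely_positive Psi & Psi \o Psi =1 Psi].

Lemma map_conj_ucp_idempotent n (U : 'M[C]_n) (Phi : 'M[C]_n -> 'M[C]_n) :
  U \is unitarymx -> ucp_idempotent_fun (map_conj U Phi) -> ucp_idempotent_fun Phi.
Proof.
move=> Uu [uPsi cpPsi idPsi].
have PhiE A : Phi A = compression (U^t*) (map_conj U Phi) A.
  rewrite /compression /map_conj trmxCK unitary_conjVK //.
  by rewrite unitary_conjVK.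
split.
- rewrite /unital PhiE /compression mulmx1 trmxCK unitarymx_adj_mul // uPsi.
  by rewrite mulmx1 (unitarymxP Uu).
- by rewrite (funext PhiE); apply: compression_cp.
move=> A /=; have /= := idPsi (U^t* *m A *m U).
rewrite /map_conj unitary_conjVK // unitary_conjVK //.
move=> /(congr1 (fun B => U *m B *m U^t*)).
by rewrite !unitary_conjVK.
Qed.

(** The Kraus operators are the matrix units [delta_mx i j], with weight
    [d i]. *)
Lemma weighted_trace_cp n (d : 'I_n -> C) : (forall i, 0 <= d i) ->
  completely_positive (fun A : 'M[C]_n => (\sum_i d i * A i i) *: (1%:M : 'M[C]_n)).
Proof.
move=> d0.
apply: (kraus_cp (s := [seq (d i, delta_mx i j) | i <- enum 'I_n, j <- enum 'I_n])).
  by move=> p /allpairsP[[i j] /= [_ _ ->]] /=.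
move=> A; rewrite big_allpairs_dep /= big_enum scaler_suml /=.
apply: eq_bigr => i _; rewrite big_enum /= scalemx1 -diag_const_mx.
rewrite [LHS]matrix_sum_delta; apply: eq_bigr => j _.
rewrite (bigD1 j) //= big1 => [|k /negPf kj].
  rewrite addr0 !mxE eqxx mulr1n ctrmx_delta delta_sandwich scalerA //.
by rewrite !mxE eq_sym kj mulr0n scale0r.
Qed.

Lemma standard_form_cp (Psi : 'M[C]_3 -> 'M[C]_3) :
  standard_form Psi -> completely_positive Psi.
Proof.
have w01 (l : C) : 0 <= l <= 1 -> (0 <= l) && (0 <= 1 - l).
  by case/andP => l0 l1; rewrite l0 subr_ge0.
have kraus s : all (fun p => 0 <= p.1) s ->
    (forall A, Psi A = \sum_(p <- s) p.1 *: (p.2^t* *m A *m p.2)) ->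
    completely_positive Psi.
  by move=> /allP s0; apply: kraus_cp => p /s0.
(* The operator [D i j] copies the diagonal entry [i] to the diagonal position
   [j] and erases the rest; [block] keeps the lower 2 x 2 block. *)
pose D (i j : 'I_3) : 'M[C]_3 := delta_mx i j.
pose block := D i1 i1 + D i2 i2.
case=> [l /w01/andP[l0 l1]|l /w01/andP[l0 l1]|l /w01/andP[l0 l1]|||l l01|] PE.
- apply: (kraus [:: (l, D i1 0); (l, D i1 i1); (l, D i1 i2);
                    (1 - l, D i2 0); (1 - l, D i2 i1); (1 - l, D i2 i2)]).
    by rewrite /= l0 l1.
  move=> A; rewrite PE /mix /entry !inord3E !big_cons big_nil /=.
  rewrite !ctrmx_delta !delta_sandwich.
  by apply/matrixP; do 2![apply: ord3P]; rewrite !mxE /=; ring.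
- apply: (kraus [:: (l, D i1 0); (1 - l, D i2 0); (1, D i1 i1); (1, D i2 i2)]).
    by rewrite /= l0 l1 ler01.
  move=> A; rewrite PE /mix /entry !inord3E !big_cons big_nil /=.
  rewrite !ctrmx_delta !delta_sandwich.
  by apply/matrixP; do 2![apply: ord3P]; rewrite !mxE /=; ring.
- apply: (kraus [:: (l, D i1 0); (1 - l, D i2 0); (1, block)]).
    by rewrite /= l0 l1 ler01.
  move=> A; rewrite PE /mix /entry !inord3E !big_cons big_nil /= ctrmxD.
  rewrite !(mulmxDl, mulmxDr) !ctrmx_delta !delta_sandwich.
  by apply/matrixP; do 2![apply: ord3P]; rewrite !mxE /=; ring.
- apply: (kraus [:: (1, D 0 0); (1, D i1 i1); (1, D i2 i2)]).
    by rewrite /= ler01.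
  move=> A; rewrite PE /mix /entry !inord3E !big_cons big_nil /=.
  rewrite !ctrmx_delta !delta_sandwich.
  by apply/matrixP; do 2![apply: ord3P]; rewrite !mxE /=; ring.
- apply: (kraus [:: (1, D 0 0); (1, block)]).
    by rewrite /= ler01.
  move=> A; rewrite PE /mix /entry !inord3E !big_cons big_nil /= ctrmxD.
  rewrite !(mulmxDl, mulmxDr) !ctrmx_delta !delta_sandwich.
  by apply/matrixP; do 2![apply: ord3P]; rewrite !mxE /=; ring.
- have [l0 l1] : 0 <= l /\ 0 <= 1 - l.
    by case/andP: l01 => l0 l1; rewrite subr_ge0 !ltW.
  apply: (kraus [:: (1, D 0 0); (l, D i1 i1); (l, D i1 i2);
                    (1 - l, D i2 i1); (1 - l, D i2 i2)]).
    by rewrite /= l0 l1 ler01.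
  move=> A; rewrite PE /mix /entry !inord3E !big_cons big_nil /=.
  rewrite !ctrmx_delta !delta_sandwich.
  by apply/matrixP; do 2![apply: ord3P]; rewrite !mxE /=; ring.
apply: (kraus [:: (1, 1%:M)]); first by rewrite /= ler01.
move=> A; rewrite PE big_cons big_nil /= ctrmx1 mul1mx mulmx1.
by rewrite scale1r addr0.
Qed.

Lemma standard_form_ucp_idempotent (Psi : 'M[C]_3 -> 'M[C]_3) :
  standard_form Psi -> ucp_idempotent_fun Psi.
Proof.
move=> std; split; last 1 first.
- move=> A /=; case: std => [l _|l _|l _|||l _|] PE; rewrite !PE //;
    rewrite /mix /entry !inord3E; apply/matrixP; do 2![apply: ord3P];
    rewrite !mxE /= ?mxE /=; ring.
- rewrite /unital; case: std => [l _|l _|l _|||l _|] PE; rewrite PE //;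
    rewrite /mix /entry !inord3E; apply/matrixP; do 2![apply: ord3P];
    rewrite !mxE /=; ring.
exact: standard_form_cp.
Qed.

Lemma state_ucp_idempotent n (Phi : {linear 'M[C]_n -> 'M[C]_n})
    (rho : {scalar 'M[C]_n}) :
  is_state rho -> (forall A, Phi A = rho A *: 1%:M) -> ucp_idempotent_fun Phi.
Proof.
move=> [rho_ge0 rho1] PE; have [U Uu [d d0 dE]] := positive_functional_diag rho_ge0.
split.
- by rewrite /unital PE rho1 scale1r.
- have cpU : completely_positive (compression U Phi).
    rewrite (_ : compression U Phi = fun A => (\sum_i d i * A i i) *: 1%:M).
      exact: weighted_trace_cp.
    apply: funext => A; rewrite /compression PE dE -scalemxAr mulmx1 -scalemxAl.
    by rewrite unitarymx_adj_mul.
  have := compression_cp (U^t*) cpU; rewrite (funext (compression_comp _ _ _)).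
  by rewrite (unitarymxP Uu) compression1.
by move=> A /=; rewrite !PE linearZ /= rho1 mulr1.
Qed.

Lemma schwarz_idem_state n (Phi : {linear 'M[C]_n.+1 -> 'M[C]_n.+1}) :
  schwarz Phi -> faithful_map Phi -> (forall A, Phi A = Phi A 0 0 *: 1%:M) ->
  exists rho : {scalar 'M[C]_n.+1},
    [/\ is_state rho, faithful_functional rho & forall A, Phi A = rho A *: 1%:M].
Proof.
move=> schPhi faith PE.
have rhoE A : Phi A = diag_entry 1%:M Phi 0 A *: 1%:M.
  by rewrite PE /diag_entry ctrmx1 mul1mx mulmx1.
have rho_ge0 := diag_entry_ge0 1%:M 0 schPhi.
exists (diag_entry 1%:M Phi 0); split=> //.
  split=> //=; rewrite /diag_entry ctrmx1 !mulmx1.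
  by case: schPhi => -> _ _; rewrite mxE.
move=> A pA A0; rewrite lt_neqAle rho_ge0 // andbT eq_sym.
apply: contra A0 => /eqP /= rhoA; apply/eqP/faith => //.
by rewrite rhoE rhoA scale0r.
Qed.

Theorem ucp_idempotent_M3 (Phi : {linear 'M[C]_3 -> 'M[C]_3}) :
  ucp_idempotent Phi <->
  (exists rho : {scalar 'M[C]_3},
     [/\ is_state rho, faithful_functional rho & forall A, Phi A = rho A *: 1%:M])
  \/ exists2 U : 'M[C]_3, U \is unitarymx & standard_form (map_conj U Phi).
Proof.
split=> [[uPhi cpPhi idPhi]|[[rho [st _ PE]]|[U Uu std]]].
- have schPhi := ucp_schwarz uPhi cpPhi.
  have [[faith PE]|[U Uu std]] := schwarz_idem_M3 (conj schPhi idPhi).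
    by left; apply: schwarz_idem_state.
  by right; exists U.
- exact: (state_ucp_idempotent st).
exact/(map_conj_ucp_idempotent Uu)/standard_form_ucp_idempotent.
Qed.

End Converse.

(** * The complex case *)

Local Open Scope complex_scope.

Theorem theorem3p9 (R : realType) (Phi : {linear 'M[R[i]]_3 -> 'M[R[i]]_3}) :
  ucp_idempotent Phi <->
  (exists rho : {scalar 'M[R[i]]_3},
     [/\ is_state rho, faithful_functional rho & forall A, Phi A = rho A *: 1%:M])
  \/
  (exists2 U : 'M[R[i]]_3, U \is unitarymx &
   let Psi := map_conj U Phi in
   let mix (l : R) (A : 'M[R[i]]_3) := l%:C * entry A 2 2 + (1 - l%:C) * entry A 3 3 in
      (* I *)
      (exists2 l : R, 0 <= l <= 1 & forall A, Psi A = mix l A *: 1%:M)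
   \/ (* II *)
      (exists2 l : R, 0 <= l <= 1 & forall A, Psi A =
         mx3 [:: [:: mix l A    ; 0          ; 0          ];
                 [:: 0          ; entry A 2 2; 0          ];
                 [:: 0          ; 0          ; entry A 3 3]])
   \/ (* III *)
      (exists2 l : R, 0 <= l <= 1 & forall A, Psi A =
         mx3 [:: [:: mix l A    ; 0          ; 0          ];
                 [:: 0          ; entry A 2 2; entry A 2 3];
                 [:: 0          ; entry A 3 2; entry A 3 3]])
   \/ (* IV *)
      (forall A, Psi A =
         mx3 [:: [:: entry A 1 1; 0          ; 0          ];
                 [:: 0          ; entry A 2 2; 0          ];
                 [:: 0          ; 0          ; entry A 3 3]])
   \/ (* V *)
      (forall A, Psi A =
         mx3 [:: [:: entry A 1 1; 0          ; 0          ];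
                 [:: 0          ; entry A 2 2; entry A 2 3];
                 [:: 0          ; entry A 3 2; entry A 3 3]])
   \/ (* VI *)
      (exists2 l : R, 0 < l < 1 & forall A, Psi A =
         mx3 [:: [:: entry A 1 1; 0          ; 0          ];
                 [:: 0          ; mix l A    ; 0          ];
                 [:: 0          ; 0          ; mix l A    ]])
   \/ (* VII *)
      (forall A, Psi A = A)).
Proof.
have cpx01 (l : R[i]) : 0 <= l <= 1 -> exists2 k : R, 0 <= k <= 1 & l = k%:C.
  move=> l01; have /complex_realP[k lE] : l \is Num.real.
    by case/andP: l01 => /ger0_real.
  by exists k; rewrite // -!lecR -lE.
have lec01 (l : R) : 0 <= l <= 1 -> 0 <= l%:C <= 1 by rewrite !lecR.
rewrite ucp_idempotent_M3.
split=> -[st|[U Uu std]]; [by left|right|by left|right]; exists U => //.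
  case: std => [l /cpx01[k k01 ->]|l /cpx01[k k01 ->]|l /cpx01[k k01 ->]
    |||l l01|] PE.
  - by left; exists k.
  - by right; left; exists k.
  - by do 2!right; left; exists k.
  - by do 3!right; left.
  - by do 4!right; left.
  - have [|k _ lE] := cpx01 l; first by case/andP: l01 => l0 l1; rewrite !ltW.
    move: l01 PE; rewrite lE !ltcR => k01 PE.
    by do 5!right; left; exists k.
  - by do 6!right.
case: std => [[l l01 PE]|[[l l01 PE]|[[l l01 PE]|[PE|[PE|[[l l01 PE]|PE]]]]]].
- exact: (FormI (lec01 _ l01)).
- exact: (FormII (lec01 _ l01)).
- exact: (FormIII (lec01 _ l01)).
- exact: FormIV.
- exact: FormV.
- by apply: (@FormVI _ _ l%:C) => //; rewrite !ltcR.
- exact: FormVII.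
Qed.
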